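(* Let $\Omega\subset \mathbb{R}^n$ be an open definable set and let $f \colon \Omega\to \mathbb{R}^n$ be a continuous definable mapping. Then the set of critical values of $f$ is of dimension strictly less than $n$, and so it has (Lebesgue) measure zero in $\mathbb{R}^n$.
   Context: Fix an o-minimal structure on $(\mathbb{R},+,\cdot)$, i.e. a sequence $(\mathcal{D}_n)_{n\in\mathbb{N}}$ such that: (a) $\mathcal{D}_n$ is a Boolean algebra of subsets of $\mathbb{R}^n$; (b) $X\in\mathcal{D}_m$, $Y\in\mathcal{D}_n$ imply $X\times Y\in\mathcal{D}_{m+n}$; (c) if $X\in\mathcal{D}_{n+1}$ then $\pi(X)\in\mathcal{D}_n$, where $\pi\colon\mathbb{R}^{n+1}\to\mathbb{R}^n$ is the projection on the first $n$ coordinates; (d) $\mathcal{D}_n$ contains all algebraic subsets of $\mathbb{R}^n$; (e) each set in $\mathcal{D}_1$ is a finite union of points and intervals. A set is definable if it belongs to some $\mathcal{D}_n$; a mapping is definable if its graph is definable. The dimension of a nonempty definable set $X$ is the maximal dimension of the manifolds in a decomposition of $X$ into a disjoint union of finitely many definable $C^p$-manifolds (for any $p \in \mathbb{N}$; it does not depend on the decomposition); the dimension of the empty set is $-\infty$. $\mathbb{B}_r(x)$ is the open Euclidean ball of center $x$ and radius $r$; $\mathrm{co}$ denotes convex hull. For $A\in\mathbb{R}^{n\times n}$, $\sigma(A):=\inf_{\|v\|=1}\|Av\|$. For $f\colon\Omega\to\mathbb{R}^n$ continuous definable with $\Omega\subset\mathbb{R}^n$ open definable, $B_f$ is the set of points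 of $\Omega$ at which $f$ is not of class $C^1$ (i.e. $f$ is not $C^1$ on any neighbourhood of the point); it is a definable nowhere dense set. For $x\in\Omega\setminus B_f$, $df(x)$ is the derivative of $f$ at $x$; for $U\subset\Omega$, $df(U):=\{df(x): x\in U\setminus B_f\}$. For $x\in\Omega$, $$\nu_f(x):=\lim_{r\to0^+}\ \inf_{A\in\mathrm{co}(df(\mathbb{B}_r(x)))}\sigma(A)\in[0,+\infty].$$ A point $x\in\Omega$ is a regular point of $f$ if $\nu_f(x)>0$ and a critical point of $f$ if $\nu_f(x)=0$. A point $y\in\mathbb{R}^n$ is a critical value of $f$ if $f^{-1}(y)$ contains at least one critical point of $f$. *)

(* Defs.v *)
From mathcomp Require Import all_boot all_order all_algebra.
From mathcomp Require Import all_classical all_reals all_analysis.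
From mathcomp.multinomials Require mpoly.
Import (canonicals) mpoly.

Set Implicit Arguments.
Unset Strict Implicit.
Unset Printing Implicit Defensive.

Import Order.TTheory GRing.Theory Num.Theory numFieldNormedType.Exports.

Local Open Scope classical_set_scope.
Local Open Scope ring_scope.

(* R^n is 'rV[R]_n, and R^m x R^n is 'rV[R]_(m + n) via lsubmx and rsubmx.   *)

Section OMinimal.
Variable R : realType.

Definition algebraic_set (n : nat) (X : set 'rV[R]_n) : Prop :=
  exists ps : seq (mpoly.mpoly n R),
    X = [set x : 'rV[R]_n | forall p : mpoly.mpoly n R,
    p \in ps -> mpoly.meval (fun i => x ord0 i) p = 0].

(* An [interval R] may be bounded or not, and may be reduced to a point. *)
Record o_minimal (D : forall n : nat, set (set 'rV[R]_n)) : Prop := OMinimal {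
  omin_set0 : forall n, D n set0;
  omin_setC : forall n X, D n X -> D n (~` X);
  omin_setU : forall n X Y, D n X -> D n Y -> D n (X `|` Y);
  omin_setX : forall m n X Y, D m X -> D n Y ->
    D (m + n)%N [set z | X (lsubmx z) /\ Y (rsubmx z)];
  omin_proj : forall n (X : set 'rV[R]_(n + 1)), D (n + 1)%N X ->
    D n ((fun z : 'rV[R]_(n + 1) => lsubmx z) @` X);
  omin_algebraic : forall n X, algebraic_set X -> D n X;
  omin_line : forall X, D 1%N X -> exists s : seq (interval R),
    X = [set x | exists2 I, I \in s & x ord0 ord0 \in I] }.

(* [f] is meaningful on [O] only; its values elsewhere are irrelevant. *)
Definition definable_map (D : forall n : nat, set (set 'rV[R]_n)) (m n : nat)
    (O : set 'rV[R]_m) (f : 'rV[R]_m -> 'rV[R]_n) : Prop :=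
  D (m + n)%N [set z | O (lsubmx z) /\ rsubmx z = f (lsubmx z)].

(* Class C^k on the open set [U]. *)
Fixpoint Ck (V W : normedModType R) (k : nat) (U : set V) (f : V -> W) : Prop :=
  match k with
  | 0 => forall x, U x -> {for x, continuous f}
  | k'.+1 => (forall x, U x -> differentiable f x) /\
             (forall v : V, Ck k' U (fun x => 'd f x v))
  end.

(* [M] is a C^p submanifold of R^n of dimension [d]: around each of its points
   some C^p diffeomorphism [phi] : U -> V of open sets of R^n, with inverse
   [psi], maps M to the linear subspace R^d x {0}. *)
Definition submanifold (p n d : nat) (M : set 'rV[R]_n) : Prop :=
  (d <= n)%N /\
  forall x, M x ->
    exists (U V : set 'rV[R]_n) (phi psi : 'rV[R]_n -> 'rV[R]_n),
      [/\ [/\ open U, U x & open V],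
          Ck p U phi /\ Ck p V psi,
          forall y, U y -> V (phi y) /\ psi (phi y) = y,
          forall z, V z -> U (psi z) /\ phi (psi z) = z &
          forall y, U y ->
            (M y <-> forall i : 'I_n, (d <= i)%N -> phi y ord0 i = 0)].

(* Pieces are nonempty, since the empty set is a manifold of any dimension. *)
Definition decomposition (D : forall n : nat, set (set 'rV[R]_n)) (p n : nat)
    (X : set 'rV[R]_n) (N : nat) (M : 'I_N -> set 'rV[R]_n) (d : 'I_N -> nat) :
    Prop :=
  [/\ X = \bigcup_i M i,
      trivIset setT M &
      forall i, [/\ D n (M i), M i !=set0 & submanifold p (d i) (M i)]].

(* All decompositions of a definable set have the same maximal dimension, so
   the supremum only selects that common value; it is -oo for the empty set.
   This is meaningful for definable sets only. *)
Definition dimension (D : forall n : nat, set (set 'rV[R]_n)) (p n : nat)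
    (X : set 'rV[R]_n) : \bar R :=
  ereal_sup [set k | exists (N : nat) (M : 'I_N -> set 'rV[R]_n)
                            (d : 'I_N -> nat),
    decomposition D p X M d /\
    k = \big[maxe/-oo%E]_(i < N) ((d i)%:R%:E : \bar R)].

(* Euclidean norm; the library's norm on matrices is the sup norm. *)
Definition enorm (m n : nat) (v : 'M[R]_(m, n)) : R :=
  Num.sqrt (\sum_i \sum_j v i j ^+ 2).

Definition eball (n : nat) (x : 'rV[R]_n) (r : R) : set 'rV[R]_n :=
  [set y | enorm (y - x) < r].

(* The infimum is taken in \bar R, hence is +oo when n = 0. *)
Definition sigma (n : nat) (A : 'M[R]_n) : \bar R :=
  ereal_inf [set (enorm (A *m v))%:E | v in [set v : 'cV[R]_n | enorm v = 1]].

Definition convex_hull (V : lmodType R) (S : set V) : set V :=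
  smallest (@convex_set R V) S.

Section CriticalValues.
Variables (n : nat) (O : set 'rV[R]_n) (f : 'rV[R]_n -> 'rV[R]_n).

Definition nonC1 : set 'rV[R]_n :=
  [set x | O x /\
     forall U : set 'rV[R]_n, open U -> U x -> U `<=` O -> ~ Ck 1 U f].

(* The library's Jacobian acts on row vectors from the right; the transpose is
   the usual matrix of the derivative. *)
Definition df_image (U : set 'rV[R]_n) : set 'M[R]_n :=
  [set (jacobian f x)^T | x in (U `&` O) `\` nonC1].

Definition nu (x : 'rV[R]_n) : \bar R :=
  lim ((fun r : R => ereal_inf
    [set sigma A | A in convex_hull (df_image (eball x r))]) @ 0^'+).

Definition critical_points : set 'rV[R]_n := [set x | O x /\ nu x = 0%E].

Definition critical_values : set 'rV[R]_n :=
  [set y | exists2 x, critical_points x & f x = y].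

End CriticalValues.

(* n-dimensional Lebesgue outer measure, by countable covers by closed boxes.
   The cover is indexed by a subset [P] of nat, so that it can be empty: when
   n = 0 every box has volume 1. *)
Definition box (n : nat) (a b : 'rV[R]_n) : set 'rV[R]_n :=
  [set x | forall i, a ord0 i <= x ord0 i <= b ord0 i].

Definition lebesgue_outer (n : nat) (X : set 'rV[R]_n) : \bar R :=
  ereal_inf [set s | exists (P : pred nat) (a b : nat -> 'rV[R]_n),
    [/\ forall k i, a k ord0 i <= b k ord0 i,
        X `<=` \bigcup_(k in [set k | P k]) box (a k) (b k) &
        s = (\sum_(0 <= k <oo | P k)
               (\prod_(i < n) (b k ord0 i - a k ord0 i))%:E)%E]].

End OMinimal.

(* Main.v *)
(* If the critical values had nonempty interior, definable choice would give, on
   some ball, a definable right inverse g of f taking values in the critical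
   points, and g is C^1 on a smaller ball. If f is C^1 at some g(y),
   then nu_f(g(y)) = 0 forces det df(g(y)) = 0, against the chain rule for
   f o g = id. Otherwise g injects a ball into the set B_f, so B_f has nonempty
   interior, which contradicts the generic smoothness of f.

   Cell decomposition is avoided: since a definable subset of R^n with empty
   interior is nowhere dense, Baire's theorem applied to countable families of
   definable sets indexed by rationals replaces every uniform finiteness
   argument. A definable set with empty interior is Lebesgue null by Fubini,
   its closure having finite fibers outside a nowhere dense set. *)
From HB Require Import structures.
Require Import Defs.
From mathcomp Require Import all_boot all_order all_algebra.
From mathcomp Require Import all_classical all_reals all_analysis.
From mathcomp Require Import ring lra.
From mathcomp.multinomials Require mpoly.
Import (canonicals) mpoly.
Import Order.TTheory GRing.Theory Num.Theory numFieldNormedType.Exports.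
Import VectorInternalTheory.
Local Open Scope classical_set_scope.
Local Open Scope ring_scope.
Set Implicit Arguments.
Unset Strict Implicit.
Unset Printing Implicit Defensive.

(** * Definable sets and maps *)

(** Only one invariant of a definable set is ever used: whether its interior is empty. A manifold
    piece of dimension n contains a ball, so empty interior already gives dimension less than n. The
    one genuinely dimension-theoretic step is that a definable function whose image contains a ball
    of R^n has a domain with nonempty interior. Continuity alone does not give this, as
    space-filling curves show. It is proved by induction on n, alternating with the impossibility of
    a definable function from R^m to R^(m+1) whose image has interior. Baire's theorem never yields
    a definable union. It singles out one index of a countable definable family, at the cost of
    shrinking the ball; hence choice, continuity and smoothness are all stated on some smaller ball.
    O-minimality speaks of first-order conditions only, so each notion is first put in that form:
    class C^1 by epsilon-delta conditions on Jacobians, convex hulls by Carathéodory's theorem,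
    Euclidean norms by sums of squares. *)

Section Definability.
Variables (R : realType) (D : forall n : nat, set (set 'rV[R]_n)).
Hypothesis HD : o_minimal D.

Lemma D_setT n : D (n := n) setT.
Proof. by rewrite -setC0; apply: (omin_setC HD); apply: (omin_set0 HD). Qed.

Lemma D_setI n (X Y : set 'rV[R]_n) : D X -> D Y -> D (X `&` Y).
Proof.
move=> DX DY; rewrite -[X]setCK -[Y]setCK -setCU.
by apply: (omin_setC HD); apply: (omin_setU HD); apply: (omin_setC HD).
Qed.

Lemma D_polys n (I : finType) (p : I -> mpoly.mpoly n R) :
  D [set x : 'rV_n | forall i, mpoly.meval (fun j => x ord0 j) (p i) = 0].
Proof.
apply: (omin_algebraic HD); exists [seq p i | i <- enum I].
apply/seteqP; split => [x px q /mapP[i _ ->] //|x px i].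
by apply: px; apply: map_f; rewrite mem_enum.
Qed.

Lemma D_proj k m (X : set 'rV[R]_(m + k)) : D X ->
  D [set x : 'rV_m | exists y : 'rV_k, X (row_mx x y)].
Proof.
(* Rows of lengths N and m' are compared through the values of their indices, which spares casts
   along N = m' + k' in the induction on k'. *)
suff H : forall N (Y : set 'rV[R]_N), D Y -> forall m' k', N = (m' + k')%N ->
    D [set x : 'rV_m' | exists2 y, Y y &
      forall (i : 'I__) (j : 'I__), i = j :> nat -> y ord0 j = x ord0 i].
  move=> DX; have := H _ _ DX _ _ erefl.
  congr D; apply/seteqP; split => x /=.
    move=> [y Xy xy]; exists (rsubmx y).
    suff -> : x = lsubmx y by rewrite hsubmxK.
    by apply/rowP => i; rewrite mxE (xy i (lshift k i)).
  move=> [y Xy]; exists (row_mx x y) => // i j ij.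
  rewrite (_ : j = lshift k i) ?row_mxEl //; exact/val_inj.
move=> {k m X} N Y DY m k; elim: k m N Y DY => [|k IH] m N Y DY.
  rewrite addn0 => Nm; case: _ / (Nm) => {Nm m}.
  move: DY; congr D; apply/seteqP; split => x /=.
    by move=> Yx; exists x => // i j /val_inj ->.
  move=> [y Yy yx]; suff -> : x = y by [].
  by apply/rowP => i; rewrite (yx i i).
rewrite addnS -addSn => Nm.
have := IH _ _ _ DY Nm; set Z := (Z in D Z).
move=> DZ.
have {}DZ : D [set x : 'rV_m | exists2 y, Z y &
    forall (i : 'I__) (j : 'I__), i = j :> nat -> y ord0 j = x ord0 i].
  clearbody Z; move: (m.+1) (addn1 m) Z DZ => q e; case: _ / (e) => {q e} Z DZ.
  have := omin_proj HD DZ; congr D; apply/seteqP; split => x /=.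
    move=> [y Zy <-]; exists y => // i j ij.
    by rewrite mxE; congr (y _ _); apply/val_inj.
  move=> [y Zy yx]; exists y => //; apply/rowP => i; rewrite mxE.
  exact: yx.
move: DZ; congr D; apply/seteqP; split => x /=.
  move=> [y [z Yz zy] yx]; exists z => // i j ij.
  by rewrite (zy (widen_ord (leqnSn m) i) j) // (yx i (widen_ord (leqnSn m) i)).
move=> [z Yz zx]; have mN : (m.+1 <= N)%N by rewrite Nm leq_addr.
exists (\row_i z ord0 (widen_ord mN i)).
  by exists z => // i j ij; rewrite mxE; congr (z _ _); exact/val_inj.
by move=> i j ij; rewrite mxE; apply: zx.
Qed.

(** The preimage is the projection of R^m x X cut by the graph of M, and this graph is the zero set
    of the linear polynomials [p j]. *)
Lemma D_mxpre m n (M : 'M[R]_(m, n)) (X : set 'rV[R]_n) :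
  D X -> D [set x : 'rV_m | X (x *m M)].
Proof.
move=> DX.
pose p (j : 'I_n) : mpoly.mpoly (m + n) R :=
  (mpoly.mpolyX R (mpoly.mnm1 (rshift m j)) -
  \sum_i M i j *: mpoly.mpolyX R (mpoly.mnm1 (lshift n i))).
have pE (v : 'I_(m + n) -> R) j : mpoly.meval v (p j) =
    v (rshift m j) - \sum_i v (lshift n i) * M i j.
  rewrite mpoly.mevalB mpoly.mevalXU.
  rewrite (big_morph _ (mpoly.mevalD v) (mpoly.meval0 v)).
  by congr (_ - _); apply: eq_bigr => i _; rewrite mpoly.mevalZ mpoly.mevalXU mulrC.
have := D_proj (D_setI (omin_setX HD (D_setT m) DX) (D_polys p)).
congr D; apply/seteqP; split => x /=.
  move=> [y [[_ Xy] /= py]]; suff -> : x *m M = y by rewrite row_mxKr in Xy.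
  apply/rowP => j; have := py j.
  rewrite pE row_mxEr => /subr0_eq ->.
  by rewrite mxE; apply: eq_bigr => i _; rewrite row_mxEl.
move=> Xx; exists (x *m M); split; first by rewrite row_mxKr.
move=> j; rewrite pE row_mxEr mxE; apply/eqP; rewrite subr_eq0; apply/eqP.
by apply: eq_bigr => i _; rewrite row_mxEl.
Qed.

(* Definability is transported along the isomorphism with R^n provided by
   vectType, so that quantifiers may range over products, matrices, ... The real
   line must be written R^o, since R itself carries no vectType structure. *)
Definition defset (V : vectType R) (X : set V) : Prop :=
  D [set r : 'rV_(dim V) | X (r2v r)].

Lemma defset_lin_rV (V : vectType R) n (L : {linear 'rV[R]_n -> V}) (X : set V) :
  defset X -> D [set x | X (L x)].
Proof.
pose M := lin1_mx (v2r \o L) => /(D_mxpre M); congr D.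
by apply/seteqP; split => x /=; rewrite mul_rV_lin1 /= v2rK.
Qed.

Lemma defset_of_D (V : vectType R) n (L : {linear V -> 'rV[R]_n}) X :
  D X -> defset [set v | X (L v)].
Proof.
move=> DX; have := D_mxpre (lin1_mx (L \o r2v)) DX; congr D.
by apply/seteqP; split => x /=; rewrite mul_rV_lin1.
Qed.

Lemma defsetE n (X : set 'rV[R]_n) : defset X <-> D X.
Proof.
split => [/(defset_lin_rV idfun) //|]; exact: (defset_of_D idfun).
Qed.

Lemma defset_lin (V W : vectType R) (L : {linear V -> W}) (X : set W) :
  defset X -> defset [set v | X (L v)].
Proof. by move=> /(defset_lin_rV (L \o r2v)). Qed.

Section Calculus.
Variable V : vectType R.
Implicit Types (X Y : set V) (W U : vectType R).

Lemma defset_ext X Y : (forall v, X v <-> Y v) -> defset X -> defset Y.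
Proof. by move=> XY; rewrite (_ : X = Y) //; apply/seteqP; split=> v /XY. Qed.

Lemma defset_not X : defset X -> defset (fun v => ~ X v).
Proof. by move/(omin_setC HD). Qed.

Lemma defset_or X Y : defset X -> defset Y -> defset (fun v => X v \/ Y v).
Proof. exact: (omin_setU HD). Qed.

Lemma defset_and X Y : defset X -> defset Y -> defset (fun v => X v /\ Y v).
Proof. exact: D_setI. Qed.

Lemma defset_imp X Y : defset X -> defset Y -> defset (fun v => X v -> Y v).
Proof.
move=> DX DY; apply: (defset_ext (X := fun v => ~ X v \/ Y v)).
  move=> v; split; first by case.
  by move=> XY; have [/XY|] := pselect (X v); [right|left].
by apply: defset_or => //; apply: defset_not.
Qed.

Lemma defset_true : defset (fun _ : V => True).
Proof. exact: D_setT. Qed.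

Lemma defset_false : defset (fun _ : V => False).
Proof. exact: (omin_set0 HD). Qed.

Lemma defset_const (P : Prop) : defset (fun _ : V => P).
Proof.
have [p|np] := pselect P.
  by apply: defset_ext defset_true.
by apply: defset_ext defset_false.
Qed.

End Calculus.

Section Quantifiers.
Variable V : vectType R.
Implicit Types (X Y : set V) (W U : vectType R).

Lemma defset_ex W (P : V -> W -> Prop) :
  defset (fun p : V * W => P p.1 p.2) -> defset (fun v => exists w, P v w).
Proof.
pose f (z : 'rV[R]_(dim V + dim W)) : V * W :=
  (r2v (lsubmx z), r2v (rsubmx z)).
have fL : linear f.
  by move=> a x y; congr pair; rewrite /= !linearP.
pose L : {linear _ -> _} := HB.pack f (GRing.isLinear.Build _ _ _ _ f fL).
move=> /(defset_lin_rV L) /D_proj; congr D; apply/seteqP; split => x /=.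
  by move=> [y]; rewrite row_mxKl row_mxKr => P1; eexists; exact: P1.
move=> [w Pw]; exists (v2r w).
by rewrite row_mxKl row_mxKr v2rK.
Qed.

Lemma defset_all W (P : V -> W -> Prop) :
  defset (fun p : V * W => P p.1 p.2) -> defset (fun v => forall w, P v w).
Proof.
move=> DP; apply: (defset_ext (X := fun v => ~ exists w, ~ P v w)).
  move=> v; split; last by move=> H [w]; apply.
  by move=> H w; apply: contrapT => Pw; apply: H; exists w.
by apply: defset_not; apply: defset_ex; apply: defset_not.
Qed.

Lemma defset_all_fin (I : finType) (P : I -> V -> Prop) :
  (forall i, defset (P i)) -> defset (fun v => forall i, P i v).
Proof.
move=> DP; apply: (defset_ext (X := fun v => forall i, i \in enum I -> P i v)).
  by move=> v; split => [H i|H i _]; apply: H; rewrite mem_enum.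
elim: (enum I) => [|i s IH]; first by apply: defset_ext (defset_true _).
apply: defset_ext (defset_and (DP i) IH) => v; split => [[Pi H] j|H].
  by rewrite inE => /orP[/eqP ->|/H].
by split => [|j js]; apply: H; rewrite !inE ?eqxx ?js ?orbT.
Qed.

End Quantifiers.

Definition defmap (V W : vectType R) (f : V -> W) : Prop :=
  defset (fun p : V * W => p.2 = f p.1).

Lemma defset_eq0 (V : vectType R) : defset (fun v : V => v = 0).
Proof.
pose p (j : 'I_(dim V)) : mpoly.mpoly (dim V) R :=
  mpoly.mpolyX R (mpoly.mnm1 j).
have := D_polys p; congr D; apply/seteqP; split => x /= H.
  suff -> : x = 0 by rewrite linear0.
  by apply/rowP => i; have := H i; rewrite mpoly.mevalXU mxE.
have {H} -> : x = 0 by apply: (can_inj r2vK); rewrite H linear0.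
by move=> i; rewrite mpoly.mevalXU mxE.
Qed.

Lemma defmap_lin (V W : vectType R) (L : {linear V -> W}) : defmap L.
Proof.
pose f (p : V * W) : W := p.2 - L p.1.
have fL : linear f.
  move=> a x y; rewrite /f /= linearP /= scalerBr opprD addrACA.
  by congr (_ + _); rewrite addrC.
pose f' : {linear _ -> _} := HB.pack f (GRing.isLinear.Build _ _ _ _ f fL).
apply: defset_ext (defset_lin f' (defset_eq0 W)) => -[v w] /=.
by split => [/subr0_eq|->]; rewrite /f /= ?subrr.
Qed.

Lemma defmap_comp_set (V W : vectType R) (f : V -> W) (X : set W) :
  defmap f -> defset X -> defset (fun v => X (f v)).
Proof.
move=> df DX; apply: (defset_ext (X := fun v => exists w, w = f v /\ X w)).
  by move=> v; split => [[w [-> //]]|Xv]; exists (f v).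
apply: defset_ex; apply: defset_and => //.
exact: (defset_lin snd DX).
Qed.

Lemma defmap_comp (V W U : vectType R) (f : V -> W) (g : W -> U) :
  defmap f -> defmap g -> defmap (fun v => g (f v)).
Proof.
move=> df dg.
apply: (defset_ext (X := fun p => exists w, w = f p.1 /\ p.2 = g w)).
  by move=> v; split => [[w [-> //]]|Xv]; exists (f v.1).
apply: defset_ex; apply: defset_and.
  pose h (q : V * U * W) := (q.1.1, q.2).
  have hL : linear h by [].
  pose L : {linear _ -> _} := HB.pack h (GRing.isLinear.Build _ _ _ _ h hL).
  exact: (defset_lin L df).
pose h (q : V * U * W) := (q.2, q.1.2).
have hL : linear h by [].
pose L : {linear _ -> _} := HB.pack h (GRing.isLinear.Build _ _ _ _ h hL).
exact: (defset_lin L dg).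
Qed.

Lemma defmap_lincomp (V W U : vectType R) (f : V -> W) (g : W -> U) :
  linear g -> defmap f -> defmap (fun v => g (f v)).
Proof.
move=> gL df; apply: defmap_comp => //.
pose L : {linear _ -> _} := HB.pack g (GRing.isLinear.Build _ _ _ _ g gL).
exact: (defmap_lin L).
Qed.

Lemma defmap_id (V : vectType R) : defmap (fun v : V => v).
Proof. exact: (defmap_lin idfun). Qed.

Lemma defmap_fst (V W U : vectType R) (f : V -> W * U) :
  defmap f -> defmap (fun v => (f v).1).
Proof. exact: (defmap_lincomp (g := fst)). Qed.

Lemma defmap_snd (V W U : vectType R) (f : V -> W * U) :
  defmap f -> defmap (fun v => (f v).2).
Proof. exact: (defmap_lincomp (g := snd)). Qed.

Lemma defmap_pair (V W U : vectType R) (f : V -> W) (g : V -> U) :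
  defmap f -> defmap g -> defmap (fun v => (f v, g v)).
Proof.
move=> df dg; apply: (defset_ext (X := fun p =>
  p.2.1 = f p.1 /\ p.2.2 = g p.1)).
  by move=> [v [w u]] /=; split => [[-> ->]|[-> ->]].
apply: defset_and.
  pose h (q : V * (W * U)) := (q.1, q.2.1).
  have hL : linear h by [].
  pose L : {linear _ -> _} := HB.pack h (GRing.isLinear.Build _ _ _ _ h hL).
  exact: (defset_lin L df).
pose h (q : V * (W * U)) := (q.1, q.2.2).
have hL : linear h by [].
pose L : {linear _ -> _} := HB.pack h (GRing.isLinear.Build _ _ _ _ h hL).
exact: (defset_lin L dg).
Qed.

Lemma defmap_add (V W : vectType R) (f g : V -> W) :
  defmap f -> defmap g -> defmap (fun v => f v + g v).
Proof.
move=> df dg; apply: (defmap_lincomp (f := fun v => (f v, g v))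
  (g := fun p : W * W => p.1 + p.2)).
  by move=> a x y /=; rewrite scalerDr addrACA.
exact: defmap_pair.
Qed.

Lemma defmap_opp (V W : vectType R) (f : V -> W) :
  defmap f -> defmap (fun v => - f v).
Proof.
by apply: defmap_lincomp => a x y; rewrite opprD scalerN.
Qed.

Lemma defset_eq (V W : vectType R) (f g : V -> W) :
  defmap f -> defmap g -> defset (fun v => f v = g v).
Proof.
move=> df dg.
apply: (defset_ext (X := fun v => f v - g v = 0)).
  by move=> v; split => [/subr0_eq|->]; rewrite ?subrr.
apply: (defmap_comp_set (f := fun v => f v - g v) _ (defset_eq0 W)).
by apply: defmap_add => //; apply: defmap_opp.
Qed.

Lemma defset_mul : defset (fun p : R^o * R^o * R^o => p.2 = p.1.1 * p.1.2 :> R).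
Proof.
pose x (i : 'I_3) : mpoly.mpoly 3 R := mpoly.mpolyX R (mpoly.mnm1 i).
pose p : mpoly.mpoly 3 R := x 2%:R - x 0 * x 1.
pose f (q : R^o * R^o * R^o) : 'rV[R]_3 :=
  \row_i if i == 0 then q.1.1 : R else if i == 1 then q.1.2 else q.2.
have fL : linear f.
  move=> a u v; apply/rowP => i; rewrite !mxE /=.
  by case: ifP => // _; case: ifP.
pose L : {linear _ -> _} := HB.pack f (GRing.isLinear.Build _ _ _ _ f fL).
apply: defset_ext (defset_of_D L (D_polys (fun _ : unit => p))) => -[[a b] c] /=.
rewrite /p mpoly.mevalB mpoly.mevalM !mpoly.mevalXU /f !mxE /=.
by split => [/(_ tt)/subr0_eq|-> _]; rewrite ?subrr.
Qed.

Lemma defmap_cst (V W : vectType R) (w : W) : defmap (fun _ : V => w).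
Proof.
suff Hw : defset (fun u : W => u = w) by exact: (defset_lin snd Hw).
(* The singleton of 1 is cut out as the neutral element of multiplication; the singleton of w is
   then its image under the linear map sending t to [t *: w]. *)
have {}H1 : defset (fun u : R^o => u = 1 :> R).
  apply: (defset_ext (X := fun u : R^o => forall t : R^o, t = u * t :> R)).
    move=> u; split; last by move=> -> t; rewrite mul1r.
    by move=> /(_ 1); rewrite mulr1.
  apply: defset_all.
  pose f (q : R^o * R^o) : R^o * R^o * R^o := ((q.1, q.2), q.2).
  have fL : linear f by [].
  pose L : {linear _ -> _} := HB.pack f (GRing.isLinear.Build _ _ _ _ f fL).
  exact: (defset_lin L defset_mul).
apply: (defset_ext (X := fun u : W => exists t : R^o, t = 1 :> R /\ u = t *: w)).
  move=> u; split; first by move=> [t [-> ->]]; rewrite scale1r.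
  by move=> ->; exists 1; rewrite scale1r.
apply: defset_ex; apply: defset_and; first exact: (defset_lin snd H1).
apply: defset_eq; first exact: (defmap_lin fst).
apply: (defmap_lincomp (g := fun t : R^o => t *: w)); last exact: (defmap_lin snd).
by move=> a x y; rewrite scalerDl scalerA.
Qed.

Lemma defmap_mul (V : vectType R) (f g : V -> R^o) :
  defmap f -> defmap g -> defmap (fun v => f v * g v : R^o).
Proof.
move=> df dg; apply: (defmap_comp (f := fun v => (f v, g v))
  (g := fun p : R^o * R^o => p.1 * p.2 : R^o)).
  exact: defmap_pair.
exact: defset_mul.
Qed.

(** The order comes from the field structure: the nonnegative reals are the squares. *)
Lemma defset_le (V : vectType R) (f g : V -> R^o) :
  defmap f -> defmap g -> defset (fun v => (f v <= g v :> R)).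
Proof.
move=> df dg.
apply: (defset_ext (X := fun v => exists t : R^o, g v = f v + t * t)).
  move=> v; split; first by move=> [t ->]; rewrite lerDl -expr2 sqr_ge0.
  move=> fg; exists (Num.sqrt (g v - f v)).
  by rewrite -expr2 sqr_sqrtr ?subr_ge0 // addrC subrK.
apply: defset_ex; apply: defset_eq.
  by apply: (defmap_comp (f := fst)); [exact: (defmap_lin fst)|].
apply: defmap_add.
  by apply: (defmap_comp (f := fst)); [exact: (defmap_lin fst)|].
by apply: defmap_mul; exact: (defmap_lin snd).
Qed.

Lemma defset_lt (V : vectType R) (f g : V -> R^o) :
  defmap f -> defmap g -> defset (fun v => (f v < g v :> R)).
Proof.
move=> df dg; apply: (defset_ext (X := fun v => ~ (g v <= f v :> R))).
  by move=> v; rewrite ltNge; split => /negP.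
by apply: defset_not; apply: defset_le.
Qed.

Lemma defmap_norm (V : vectType R) (f : V -> R^o) :
  defmap f -> defmap (fun v => `|f v : R| : R^o).
Proof.
move=> df; apply: (defmap_comp (g := fun t : R^o => `|t : R| : R^o) df).
apply: (defset_ext (X := fun p : R^o * R^o => (0 <= p.1 :> R) /\ p.2 = p.1 \/
   (p.1 <= 0 :> R) /\ p.2 = - p.1)).
  move=> [x y] /=; split.
    by move=> [[x0 ->]|[x0 ->]]; [rewrite ger0_norm|rewrite ler0_norm].
  move=> ->; have [x0|/ltW x0] := leP 0 (x : R).
    by left; split => //; rewrite ger0_norm.
  by right; split => //; rewrite ler0_norm.
have d1 : defmap (fst : R^o * R^o -> R^o) by exact: (defmap_lin fst).
have d2 : defmap (snd : R^o * R^o -> R^o) by exact: (defmap_lin snd).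
apply: defset_or; apply: defset_and.
- by apply: defset_le => //; apply: defmap_cst.
- by apply: defset_eq.
- by apply: defset_le => //; apply: defmap_cst.
- by apply: defset_eq => //; apply: defmap_opp.
Qed.

Lemma defmap_coord (V : vectType R) m n (f : V -> 'M[R]_(m, n)) i j :
  defmap f -> defmap (fun v => f v i j : R^o).
Proof.
by apply: (defmap_lincomp (g := fun M : 'M[R]_(m, n) => M i j : R^o)) => a x y;
  rewrite !mxE.
Qed.

Lemma defmap_ffun (V W : vectType R) (I : finType) (f : V -> {ffun I -> W}) i :
  defmap f -> defmap (fun v => f v i).
Proof.
by apply: (defmap_lincomp (g := fun F : {ffun I -> W} => F i)) => a x y;
  rewrite !ffunE.
Qed.

Lemma defmap_sum (V W : vectType R) (I : finType) (f : I -> V -> W) :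
  (forall i, defmap (f i)) -> defmap (fun v => \sum_i f i v).
Proof.
move=> df; rewrite unlock /=.
elim: (index_enum I) => [|i s IH] /=; first exact: defmap_cst.
by apply: defmap_add.
Qed.

Lemma defmap_matrix (V : vectType R) m n (f : V -> 'M[R]_(m, n)) :
  (forall i j, defmap (fun v => f v i j : R^o)) -> defmap f.
Proof.
move=> df; apply: (defset_ext (X := fun p : V * 'M[R]_(m, n) =>
    forall i j, p.2 i j = f p.1 i j)).
  by move=> p; split => [?|-> //]; apply/matrixP.
apply: defset_all_fin => i; apply: defset_all_fin => j; apply: defset_eq.
  by apply: defmap_coord; exact: (defmap_lin snd).
apply: (defmap_comp (f := fst) (g := fun v => f v i j : R^o)) => //.
exact: (defmap_lin fst).
Qed.

Lemma defmap_scale (V W : vectType R) (f : V -> R^o) (g : V -> W) :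
  defmap f -> defmap g -> defmap (fun v => f v *: g v).
Proof.
move=> df dg; apply: (defset_ext (X := fun p : V * W =>
  forall i : 'I_(dim W), v2r p.2 ord0 i = f p.1 * v2r (g p.1) ord0 i)).
  move=> p; split; last by move=> -> i; rewrite linearZ mxE.
  move=> H; apply: v2r_inj; apply/rowP => i; rewrite H linearZ mxE //.
apply: defset_all_fin => i.
have d1 : defmap (fst : V * W -> V) by exact: (defmap_lin fst).
have d2 : defmap (snd : V * W -> W) by exact: (defmap_lin snd).
have dv : defmap (v2r : W -> 'rV_(dim W)) by exact: (defmap_lin v2r).
apply: defset_eq; first by apply: defmap_coord; apply: defmap_comp dv.
apply: defmap_mul; first exact: defmap_comp df.
by apply: defmap_coord; apply: defmap_comp dv; exact: defmap_comp dg.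
Qed.

End Definability.

(** Completeness of matrices as a normed space, on which Baire's theorem rests. *)
HB.instance Definition _ (R : realType) (m n : nat) :=
  Complete.copy (matrix R m n) (matrix R m n).

Ltac dstep :=
  let H := match goal with H : o_minimal _ |- _ => H end in
  let R := match type of H with @o_minimal ?R _ => R end in
  cbv beta;
  lazymatch goal with
  | |- defset _ _ => first
    [ assumption
    | apply: (defset_const H)
    | apply: (defset_not H)
    | apply: (defset_and H)
    | apply: (defset_or H)
    | apply: (defset_imp H)
    | apply: (defset_lt H)
    | apply: (defset_le H)
    | apply: (defset_eq H)
    | apply: (defset_eq H (W := R^o))
    | match goal with K : defset _ ?X |- _ =>
        apply: (defmap_comp_set H (X := X) _ K) end
    | apply: (defset_all H)
    | apply: (defset_all H (W := R^o))
    | apply: (defset_ex H)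
    | apply: (defset_ex H (W := R^o))
    | apply: (defset_all_fin H) => ? ]
  | |- defmap _ _ => first
    [ assumption
    | apply: (defmap_cst H)
    | apply: (defmap_id H)
    | apply: (defmap_fst H)
    | apply: (defmap_snd H)
    | apply: (defmap_pair H)
    | apply: (defmap_add H)
    | apply: (defmap_opp H)
    | apply: (defmap_mul H)
    | apply: (defmap_scale H)
    | apply: (defmap_norm H)
    | apply: (defmap_sum H) => ?
    | apply: (defmap_coord H)
    | apply: (defmap_ffun H)
    | match goal with K : defmap _ ?g |- _ =>
        apply: (defmap_comp H (g := g) _ K) end ]
  | |- forall _, _ => move=> ?
  end.
(* Proves definability by following the first-order syntax of the set. *)
Ltac definable := repeat dstep.

(** * Definable subsets of the real line *)

Section Line.
Variables (R : realType) (D : forall n : nat, set (set 'rV[R]_n)).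
Hypothesis HD : o_minimal D.

Lemma defset_line (S : set R^o) : defset D S -> exists s : seq (interval R),
  S = [set t | exists2 I, I \in s & (t : R) \in I].
Proof.
pose f (x : 'rV[R]_1) : R^o := x ord0 ord0.
have fL : linear f by move=> a x y; rewrite /f !mxE.
pose L : {linear _ -> _} := HB.pack f (GRing.isLinear.Build _ _ _ _ f fL).
move=> /(defset_lin_rV HD L) /(omin_line HD)[s Ss]; exists s.
apply/seteqP; split => t /=.
  move=> St; have : [set x | S (L x)] (\row__ (t : R)) by rewrite /= /f mxE.
  by rewrite Ss => -[I Is]; rewrite mxE => tI; exists I.
move=> [I Is tI]; have : [set x | S (L x)] (\row__ (t : R)).
  by rewrite Ss; exists I => //; rewrite mxE.
by rewrite /= /f mxE.
Qed.

(** Either one of the finitely many intervals has two distinct points, hence contains an open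
    interval, or each has at most one point. *)
Lemma defset_line_finite (S : set R^o) : defset D S ->
  (exists u v : R, u < v /\ forall t : R, u < t < v -> S t) \/
  (exists s : seq R, forall t : R, S t -> t \in s).
Proof.
move=> /defset_line[s ->].
have [H|H] := pselect (exists u v : R, u < v /\ forall t : R, u < t < v ->
  [set t | exists2 I, I \in s & (t : R) \in I] t); first by left.
right; elim: s H => [|I s IH] H; first by exists [::] => t [].
have [|s' Hs'] := IH.
  move=> [u [v [uv Huv]]]; apply: H; exists u, v; split => // t /Huv[J Js tJ].
  by exists J; rewrite // inE Js orbT.
have [[a aI]|nI] := pselect (exists a, a \in I); last first.
  exists s' => t [J]; rewrite inE => /orP[/eqP -> tI|Js tJ].
    by case: nI; exists t.
  by apply: Hs'; exists J.
exists (a :: s') => t [J]; rewrite !inE => /orP[/eqP -> tI|Js tJ]; last first.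
  by apply/orP; right; apply: Hs'; exists J.
apply/orP; left; apply/negP => /negP ta; apply: H.
exists (Num.min t a), (Num.max t a); split.
  by rewrite lt_max !gt_min !ltxx orbF; move: ta; case: ltgtP.
move=> w /andP[mw wM]; exists I; first by rewrite inE eqxx.
have := @interval_is_interval _ I; move/(_ (Num.min t a) (Num.max t a)).
apply; last by rewrite !ltW.
  by rewrite /= minElt; case: ifP.
by rewrite /= maxElt; case: ifP.
Qed.

(** An interval with points arbitrarily close to a on the right contains some ]a, a + d[, and
    finitely many others can be avoided by shrinking d. This decides the one-sided behaviour of
    difference quotients. *)
Lemma defset_line_right (S : set R^o) (a : R) : defset D S ->
  exists2 d : R, 0 < d &
  (forall t : R, a < t < a + d -> S t) \/ (forall t : R, a < t < a + d -> ~ S t).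
Proof.
move=> /defset_line[s ->].
elim: s => [|I s [d d0 IH]]; first by exists 1 => //; right => t _ [].
have [H|H] := pselect (forall e, 0 < e -> exists2 t : R, a < t < a + e & t \in I).
  have [u /andP[au _] uI] := H 1 ltr01.
  exists (u - a); first by rewrite subr_gt0.
  left => t; rewrite addrC subrK => /andP[at_ tu].
  have [|v /andP[av] vt vI] := H (t - a); first by rewrite subr_gt0.
  exists I; first by rewrite inE eqxx.
  apply: (@interval_is_interval _ I v u) => //.
  by rewrite (ltW tu) andbT ltW //; rewrite addrC subrK in vt.
have {H} [e e0 He] : exists2 e, 0 < e & forall t : R, a < t < a + e -> t \notin I.
  apply: contrapT => K; apply: H => e e0; apply: contrapT => L; apply: K.
  by exists e => // t ht; apply/negP => tI; apply: L; exists t.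
exists (Num.min d e); first by rewrite lt_min d0.
case: IH => IH; [left|right] => t /andP[at_]; rewrite -ltrBlDl lt_min !ltrBlDl.
  move=> /andP[td te]; have [|J Js tJ] := IH t; first by rewrite at_.
  by exists J; rewrite // inE Js orbT.
move=> /andP[td te] [J]; rewrite inE => /orP[/eqP -> tI|Js tJ].
  by have := He t; rewrite at_ te tI => /(_ isT).
by apply: (IH t); [rewrite at_|exists J].
Qed.

Lemma finite_isolated (s : seq R) (y : R) : exists2 d, 0 < d &
  forall t, t \in s -> `|t - y| < d -> t = y.
Proof.
elim: s => [|a s [d d0 IH]]; first by exists 1.
have [->|ay] := eqVneq a y.
  by exists d => // t; rewrite inE => /orP[/eqP ->|/IH] //.
exists (Num.min d `|a - y|); first by rewrite lt_min d0 normr_gt0 subr_eq0.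
move=> t; rewrite inE lt_min => /orP[/eqP ->|ts] /andP[td ta].
  by rewrite ltxx in ta.
exact: IH.
Qed.

Lemma rat_between (x y : R) : x < y -> exists q : rat, x < ratr q < y.
Proof.
by move=> /rat_in_itvoo[q]; rewrite in_itv /=; exists q.
Qed.

End Line.

(** * Definable sets with empty interior are nowhere dense *)

Section Insert.
Variables (R : realType) (n : nat).
Implicit Types (k : 'I_n.+1) (x : 'rV[R]_n) (z : 'rV[R]_n.+1) (t : R).

(** The position k is arbitrary because the coordinate that depends on the others varies with the
    piece in [thin_cover]. *)
Definition ins k x t : 'rV[R]_n.+1 := \row_i oapp (x ord0) t (unlift k i).

Lemma ins_at k x t : ins k x t ord0 k = t.
Proof. by rewrite mxE unlift_none. Qed.

Lemma ins_lift k x t j : ins k x t ord0 (lift k j) = x ord0 j.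
Proof. by rewrite mxE liftK. Qed.

Lemma col'_ins k x t : col' k (ins k x t) = x.
Proof. by apply/rowP => j; rewrite mxE ins_lift. Qed.

Lemma ins_col' k z : ins k (col' k z) (z ord0 k) = z.
Proof. by apply/rowP => j; rewrite mxE; case: unliftP => [i|] -> //=; rewrite mxE. Qed.

Lemma rV_ballP m (x y : 'rV[R]_m) r :
  ball x r y <-> 0 < r /\ forall i, `|x ord0 i - y ord0 i| < r.
Proof.
split => -[r0 H]; split => // i; first exact: (H ord0 i).
by move=> j; rewrite ord1; apply: H.
Qed.

Lemma ins_ball k x y t u r :
  ball (ins k x t) r (ins k y u) <-> ball x r y /\ `|t - u| < r.
Proof.
rewrite !rV_ballP; split.
  move=> [r0 H]; split; last by have := H k; rewrite !ins_at.
  by split => // i; have := H (lift k i); rewrite !ins_lift.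
move=> [[r0 H] tu]; split => // i.
by case: (unliftP k i) => [j|] ->; rewrite ?ins_lift ?ins_at.
Qed.

End Insert.

Definition has_interior (R : realType) n (E : set 'rV[R]_n) :=
  exists x r, 0 < r /\ ball x r `<=` E.

Lemma has_interior_sub (R : realType) n (E F : set 'rV[R]_n) :
  E `<=` F -> has_interior E -> has_interior F.
Proof. by move=> EF [x [r [r0 H]]]; exists x, r; split => // y /H /EF. Qed.

Lemma ball_sub (R : realType) n (x y : 'rV[R]_n) r : ball x r y ->
  exists2 s, 0 < s & ball y s `<=` ball x r.
Proof.
move=> xy; have [r0 _] := xy.
have : nbhs y (ball x r) by apply: open_nbhs_nbhs; split=> //; exact: ball_open.
by rewrite -nbhs_ballE => -[s s0 H]; exists s.
Qed.

Lemma min_lel (R : realType) (a b : R) : Num.min a b <= a.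
Proof. by rewrite ge_min lexx. Qed.

Lemma min_ler (R : realType) (a b : R) : Num.min a b <= b.
Proof. by rewrite ge_min lexx orbT. Qed.

Section Category.
Variables (R : realType) (D : forall n : nat, set (set 'rV[R]_n)).
Hypothesis HD : o_minimal D.

Lemma defmap_ins (V : vectType R) n (k : 'I_n.+1) (f : V -> 'rV[R]_n) (g : V -> R^o) :
  defmap D f -> defmap D g -> defmap D (fun v => ins k (f v) (g v)).
Proof.
move=> df dg; apply: defmap_matrix => // i j; rewrite ord1.
case: (unliftP k j) => [l|] ->.
  have -> : (fun v => ins k (f v) (g v) ord0 (lift k l) : R^o) =
    (fun v => f v ord0 l : R^o) by apply/funext => v; rewrite ins_lift.
  by definable.
by have -> : (fun v => ins k (f v) (g v) ord0 k : R^o) = g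
  by apply/funext => v; rewrite ins_at.
Qed.

Lemma defmap_col' (V : vectType R) n (k : 'I_n.+1) (f : V -> 'rV[R]_n.+1) :
  defmap D f -> defmap D (fun v => col' k (f v)).
Proof.
move=> df; apply: defmap_matrix => // i j.
have -> : (fun v => col' k (f v) i j : R^o) = (fun v => f v i (lift k j) : R^o).
  by apply/funext => v; rewrite mxE.
by definable.
Qed.

Lemma defset_ball (V : vectType R) n (f g : V -> 'rV[R]_n) (r : V -> R^o) :
  defmap D f -> defmap D g -> defmap D r -> defset D (fun v => ball (f v) (r v) (g v)).
Proof.
move=> df dg dr; apply: (defset_ext (X := fun v => 0 < r v /\
  forall i, `|f v ord0 i - g v ord0 i| < r v)).
  by move=> v; rewrite rV_ballP.
by definable.
Qed.

Definition ndense n := forall E : set 'rV[R]_n, defset D E -> ~ has_interior E ->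
  forall x r, 0 < r -> exists y s,
    [/\ 0 < s, ball y s `<=` ball x r & forall z, ball y s z -> ~ E z].

(** The complements of the [E k] have dense interiors by [ndense]. The union of the [E k] need not
    be definable, so o-minimality could not be applied to it directly. *)
Lemma baire_of_ndense n : ndense n -> forall E : nat -> set 'rV[R]_n,
  (forall k, defset D (E k)) -> (forall k, ~ has_interior (E k)) ->
  forall x r, 0 < r -> exists2 y, ball x r y & forall k, ~ E k y.
Proof.
move=> nd E DE nE x r r0.
pose F k : set 'rV[R]_n := (~` E k)^°.
have FO k : open (F k) /\ dense (F k).
  split; first exact: open_interior.
  move=> O [a Oa] Oop.
  have : nbhs a O by exact: open_nbhs_nbhs.
  rewrite -nbhs_ballE => -[e e0 eO].
  have [y [s [s0 ys yE]]] := nd _ (DE k) (nE k) a e e0.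
  exists y; split; first by apply/eO/ys; exact: ballxx.
  by apply/nbhs_ballP; exists s.
have /(_ (ball x r)) [||y [xy Fy]] := Baire FO.
- by exists x; exact: ballxx.
- exact: ball_open.
- exists y => // k Ey; have := Fy k I.
  by move/interior_subset.
Qed.

Lemma baire_countable n (T : countType) : ndense n -> forall E : T -> set 'rV[R]_n,
  (forall k, defset D (E k)) -> (forall k, ~ has_interior (E k)) ->
  forall x r, 0 < r -> exists2 y, ball x r y & forall k, ~ E k y.
Proof.
move=> nd E DE nE x r r0.
pose F k : set 'rV[R]_n := if unpickle k is Some t then E t else set0.
have [|k|y xy Fy] := baire_of_ndense nd (E := F) _ _ x r0.
- by move=> k; rewrite /F; case: unpickle => // *; exact: defset_false.
- rewrite /F; case: unpickle => // -[z [e [e0]]]; move/(_ z); apply.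
  exact: ballxx.
- by exists y => // k Ey; have := Fy (pickle k); rewrite /F pickleK.
Qed.

(** Induction on n. Suppose that E has empty interior but meets every ball inside [ball x r]. The
    base points whose fiber contains a given rational interval ([A q]) have empty interior,
    otherwise E contains a box; so do those whose fiber misses a given rational interval near t0
    ([C q]), otherwise a box avoids E. By Baire in R^n some base point lies in none of these sets,
    yet its fiber either contains an interval or is finite near t0. *)
Lemma ndense_all n : ndense n.
Proof.
elim: n => [|n IH] E DE nE x r r0.
  exists x, r; split => // z _ Ez; apply: nE; exists z, r; split => // y _.
  by rewrite (_ : y = z) //; apply/rowP => -[].
pose k : 'I_n.+1 := ord0.
apply: contrapT => H.
pose x' := col' k x; pose t0 := x ord0 k.
have Ex : x = ins k x' t0 by rewrite ins_col'.
pose A (q : rat * rat) : set 'rV[R]_n := fun y => [/\ ratr q.1 < ratr q.2 :> R,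
  ball x' r y & forall t : R^o, ratr q.1 < t < ratr q.2 -> E (ins k y t)].
pose C (q : rat * rat) : set 'rV[R]_n := fun y => [/\ ratr q.1 < ratr q.2 :> R,
  ball x' r y & (t0 - r <= ratr q.1 /\ ratr q.2 <= t0 + r) /\
   forall t : R^o, ratr q.1 < t < ratr q.2 -> ~ E (ins k y t)].
have dE := defmap_ins.
have DA q : defset D (A q).
  apply: (defset_ext (X := fun y => ratr q.1 < ratr q.2 :> R /\
   (ball x' r y /\ forall t : R^o, (ratr q.1 < t /\ t < ratr q.2) -> E (ins k y t)))).
    move=> y; rewrite /A; split.
      by move=> [? [? H1]]; split => // t /andP ?; apply: H1.
    by move=> [? ? H1]; do 2!split => //; move=> t /andP ?; apply: H1.
  apply: defset_and => //; first exact: defset_const.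
  apply: defset_and => //; first by apply: defset_ball; definable.
  apply: defset_all => //; apply: defset_imp => //; first by definable.
  by apply: (defmap_comp_set HD (X := E)) => //; apply: defmap_ins; definable.
have DC q : defset D (C q).
  apply: (defset_ext (X := fun y => ratr q.1 < ratr q.2 :> R /\
   (ball x' r y /\ ((t0 - r <= ratr q.1 /\ ratr q.2 <= t0 + r) /\
    forall t : R^o, (ratr q.1 < t /\ t < ratr q.2) -> ~ E (ins k y t))))).
    move=> y; rewrite /C; split.
      by move=> [? [? [H0 H1]]]; do 2!split => //; move=> t /andP ?; apply: H1.
    by move=> [? ? [H0 H1]]; do 3!split => //; move=> t /andP ?; apply: H1.
  apply: defset_and => //; first exact: defset_const.
  apply: defset_and => //; first by apply: defset_ball; definable.
  apply: defset_and => //; first exact: defset_const.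
  apply: defset_all => //; apply: defset_imp => //; first by definable.
  apply: defset_not => //.
  by apply: (defmap_comp_set HD (X := E)) => //; apply: defmap_ins; definable.
pose G (b : bool * (rat * rat)) := if b.1 then A b.2 else C b.2.
have [||y xy Gy] := baire_countable IH (E := G) _ _ x' r0.
- by move=> [[] q]; [exact: DA|exact: DC].
- move=> [[] q] [y [s [s0 ys]]]; rewrite /G /= in ys.
    have [qq _ _] := ys y (ballxx y s0).
    set q1 : R := ratr q.1 in ys qq; set q2 : R := ratr q.2 in ys qq.
    apply: nE; exists (ins k y ((q1 + q2) / 2)), (Num.min s ((q2 - q1) / 2)).
    have e0 : 0 < Num.min s ((q2 - q1) / 2) by rewrite lt_min s0; lra.
    split => // z; rewrite -(ins_col' k z) ins_ball => -[].
    move=> /(le_ball (min_lel _ _)) /ys [_ _ H2].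
    rewrite lt_min => /andP[_]; rewrite ltr_norml => /andP[h1 h2].
    by apply: H2; apply/andP; split; lra.
  have [qq _ [[q1t q2t] _]] := ys y (ballxx y s0).
  set q1 : R := ratr q.1 in ys qq q1t; set q2 : R := ratr q.2 in ys qq q2t.
  apply: H; exists (ins k y ((q1 + q2) / 2)), (Num.min s ((q2 - q1) / 2)).
  have e0 : 0 < Num.min s ((q2 - q1) / 2) by rewrite lt_min s0; lra.
  split => // z; rewrite -(ins_col' k z) ins_ball => -[].
    move=> /(le_ball (min_lel _ _)) /ys [_ H1 _].
    rewrite lt_min => /andP[_]; rewrite ltr_norml => /andP[h1 h2].
    by rewrite Ex ins_ball; split => //; rewrite ltr_norml; apply/andP; split; lra.
  move=> /(le_ball (min_lel _ _)) /ys [_ _ [_ H1]].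
  rewrite lt_min => /andP[_]; rewrite ltr_norml => /andP[h1 h2].
  by apply: H1; apply/andP; split; lra.
have DS : defset D (fun t : R^o => t0 - r < t /\ (t < t0 + r /\ E (ins k y t))).
  apply: defset_and => //; first by definable.
  apply: defset_and => //; first by definable.
  by apply: (defmap_comp_set HD (X := E)) => //; apply: defmap_ins; definable.
have sub (u v : R) : u < v -> exists q : rat * rat,
  [/\ u < ratr q.1, ratr q.1 < ratr q.2 :> R & ratr q.2 < v].
  move=> uv; have [q /andP[uq qv]] := rat_between uv.
  have [q' /andP[uq' qv']] := rat_between qv.
  by exists (q, q').
have [[u [v [uv Huv]]]|[s Hs]] := defset_line_finite HD DS.
  have [q [uq qq qv]] := sub _ _ uv.
  apply: (Gy (true, q)); split => // t /andP[qt tq].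
  have [|_ [_ //]] := Huv t; apply/andP.
  by split; [exact: lt_trans qt|exact: lt_trans qv].
have [d d0 Hd] := finite_isolated s t0.
(* The rational interval is taken strictly to the right of t0, since t0 may itself belong to the
   finite fiber. *)
have /sub[q [tq qq qt]] : t0 < t0 + Num.min d r by rewrite ltrDl lt_min d0.
apply: (Gy (false, q)); split => //; split.
  split; first by rewrite lerBlDr (le_trans (ltW tq)) // lerDl ltW.
  by rewrite (le_trans (ltW qt)) // lerD2l ge_min lexx orbT.
move=> t /andP[qt' tq'] Et.
have tt0 : t0 < t by apply: lt_trans qt'.
have : t < t0 + Num.min d r by apply: lt_trans qt.
rewrite -ltrBlDl lt_min => /andP[td tr].
have /Hs/Hd : t0 - r < t /\ (t < t0 + r /\ E (ins k y t)).
  by split; [lra|split => //; lra].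
rewrite gtr0_norm ?subr_gt0 // => /(_ td) tt.
by rewrite tt ltxx in tt0.
Qed.

Lemma baire_def n (T : countType) (E : T -> set 'rV[R]_n) :
  (forall k, defset D (E k)) -> (forall k, ~ has_interior (E k)) ->
  forall x r, 0 < r -> exists2 y, ball x r y & forall k, ~ E k y.
Proof. exact: (baire_countable (@ndense_all n)). Qed.

End Category.

(** * Dimension *)

Ltac definable ::= repeat (
  let H := match goal with H : o_minimal _ |- _ => H end in
  cbv beta;
  first [ apply: (defset_ball H) | apply: (defmap_ins H)
        | apply: (defmap_col' H) | dstep ]).

Section Dimension.
Variables (R : realType) (D : forall n : nat, set (set 'rV[R]_n)).
Hypothesis HD : o_minimal D.

(** First-order way to say that the fiber over x in direction k is infinite: by
    [defset_line_finite], a definable fiber containing no interval is finite. *)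
Definition fat_fiber m (k : 'I_m.+1) (E : set 'rV[R]_m.+1) (x : 'rV[R]_m) :=
  exists u v : R^o, (u < v :> R) /\
    forall t : R^o, (u < t /\ t < v) -> E (ins k x t).

Lemma defset_fat_fiber m k (E : set 'rV[R]_m.+1) :
  defset D E -> defset D (fat_fiber k E).
Proof. by move=> DE; rewrite /fat_fiber; definable. Qed.

(** If fat fibers filled a ball, Baire would provide one rational interval contained in all fibers
    over a smaller ball, hence a box inside E. *)
Lemma fat_fiber_thin m k (E : set 'rV[R]_m.+1) : defset D E -> ~ has_interior E ->
  ~ has_interior (fat_fiber k E).
Proof.
move=> DE nE [x [r [r0 xA]]].
pose B (q : rat * rat) x := ratr q.1 < ratr q.2 :> R /\
  forall t : R^o, (ratr q.1 < t /\ t < ratr q.2) -> E (ins k x t).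
have [q|q [y [s [s0 ys]]]|y /xA[u [v [uv Huv]]] nB] :=
  baire_def HD (E := B) _ _ x r0.
- by rewrite /B; definable.
- have [qq _] := ys y (ballxx y s0).
  set q1 : R := ratr q.1 in ys qq; set q2 : R := ratr q.2 in ys qq.
  apply: nE; exists (ins k y ((q1 + q2) / 2)), (Num.min s ((q2 - q1) / 2)).
  have e0 : 0 < Num.min s ((q2 - q1) / 2) by rewrite lt_min s0; lra.
  split => // z; rewrite -(ins_col' k z) ins_ball => -[].
  move=> /(le_ball (min_lel _ _)) /ys [_ H2].
  rewrite lt_min => /andP[_]; rewrite ltr_norml => /andP[h1 h2].
  by apply: H2; split; lra.
have [q /andP[uq qv]] := rat_between uv.
have [q' /andP[uq' qv']] := rat_between qv.
apply: (nB (q, q')); split => // t [qt tq]; apply: Huv.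
by split; [exact: lt_trans qt|exact: lt_trans qv'].
Qed.

Lemma thin_fiber_finite m k (E : set 'rV[R]_m.+1) x : defset D E ->
  ~ fat_fiber k E x -> exists s : seq R, forall t : R, E (ins k x t) -> t \in s.
Proof.
move=> DE nA.
have DS : defset D (fun t : R^o => E (ins k x t)) by definable.
have [[u [v [uv Huv]]]|//] := defset_line_finite HD DS.
by case: nA; exists u, v; split => // t /andP /Huv.
Qed.

(** A rational window isolates each point of a finite fiber. For a fixed window, the isolated point
    is determined by its base point. *)
Lemma thin_cover_step m (E : set 'rV[R]_m.+1) : defset D E ->
  let k := ord0 in
  exists F : rat * rat -> set 'rV[R]_m.+1,
  [/\ forall t, defset D (F t),
      forall t z z', F t z -> F t z' ->
        (forall i, i != k -> z ord0 i = z' ord0 i) -> z = z' &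
      forall z, E z -> ~ fat_fiber k E (col' k z) -> exists t, F t z].
Proof.
move=> DE k.
exists (fun q z => E z /\
  (ratr q.1 < z ord0 k /\ z ord0 k < ratr q.2) /\
  (forall t : R^o, (ratr q.1 < t /\ t < ratr q.2) ->
      E (ins k (col' k z) t) -> t = z ord0 k :> R)); split.
- by move=> q; definable.
- move=> q z z' [Ez [hz H]] [Ez' [hz' H']] zz'.
  have cz : col' k z = col' k z'.
    by apply/rowP => i; rewrite !mxE; apply: zz'; rewrite eq_sym neq_lift.
  rewrite -(ins_col' k z) -(ins_col' k z') cz; congr ins.
  by apply: H' => //; rewrite -cz ins_col'.
- move=> z Ez /(thin_fiber_finite DE)[s Hs].
  have [d d0 Hd] := finite_isolated s (z ord0 k).
  have [|q /andP[q1 q2]] := @rat_between R (z ord0 k - d) (z ord0 k).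
    by rewrite ltrBlDr ltrDl.
  have [|q' /andP[q1' q2']] := @rat_between R (z ord0 k) (z ord0 k + d).
    by rewrite ltrDl.
  exists (q, q'); do 2!split => //; move=> t /= [qt tq] /Hs/Hd; apply.
  by rewrite ltr_norml; apply/andP; split; lra.
Qed.

(* A definable set with empty interior is a countable union of definable pieces
   on each of which some coordinate is a function of the others. *)
Lemma thin_cover m (E : set 'rV[R]_m.+1) : defset D E -> ~ has_interior E ->
  exists (T : countType) (F : T -> set 'rV[R]_m.+1) (k : T -> 'I_m.+1),
  [/\ forall t, defset D (F t),
      forall t z z', F t z -> F t z' ->
        (forall i, i != k t -> z ord0 i = z' ord0 i) -> z = z' &
      forall z, E z -> exists t, F t z].
Proof.
elim: m E => [|m IH] E DE nE; have [F [DF injF FE]] := thin_cover_step DE;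
  have DA := defset_fat_fiber ord0 DE; have nA := fat_fiber_thin (k := ord0) DE nE.
- exists (rat * rat)%type, F, (fun _ => ord0); split => // z Ez; apply: FE => //.
  (* Every nonempty subset of R^0 has interior, so no fiber is fat here. *)
  move=> Az; apply: nA; exists (col' ord0 z), 1; split => // y _.
  by rewrite (_ : y = col' ord0 z) //; apply/rowP => -[].
(* The base points with fat fibers form a set without interior in one dimension less. There a base
   coordinate is a function of the other base coordinates, and this persists for the points
   above. *)
have [T [F' [k' [DF' inj' F'A]]]] := IH _ DA nA.
pose k : 'I_m.+2 := ord0.
pose G (t : rat * rat + T) z :=
  match t with inl q => F q z | inr t => F' t (col' k z) end.
exists (rat * rat + T)%type, G, (fun t : rat * rat + T =>
  if t is inr t then lift k (k' t) else k); split.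
- move=> [q|t]; first exact: DF.
  by have DFt := DF' t; rewrite /G; definable.
- move=> [q|t] //= z z' Fz Fz' zz'; first exact: injF Fz Fz' zz'.
  have e0 : z ord0 k = z' ord0 k by apply: zz'; rewrite neq_lift.
  have ec : col' k z = col' k z'.
    apply: (inj' t) => // i ik; rewrite !mxE; apply: zz'.
    by rewrite (inj_eq lift_inj).
  by rewrite -(ins_col' k z) -(ins_col' k z') ec e0.
- move=> z Ez.
  have [/F'A[t]|/(FE z Ez)[q]] := pselect (fat_fiber k E (col' k z)).
    by exists (inr t).
  by exists (inl q).
Qed.

Definition functional (X Y : Type) (G : X -> Y -> Prop) :=
  forall x y y', G x y -> G x y' -> y = y'.

(* The slices of the image have domains that are pairwise disjoint and have
   nonempty interior, so each of them contains a rational point. *)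
Lemma no_dim_raise_of m :
  (forall G : 'rV[R]_m -> 'rV[R]_m -> Prop,
    defset D (fun p : 'rV[R]_m * 'rV[R]_m => G p.1 p.2) -> functional G ->
    has_interior (fun y => exists x, G x y) ->
    has_interior (fun x => exists y, G x y)) ->
  forall G : 'rV[R]_m -> 'rV[R]_m.+1 -> Prop,
    defset D (fun p : 'rV[R]_m * 'rV[R]_m.+1 => G p.1 p.2) -> functional G ->
    ~ has_interior (fun y => exists x, G x y).
Proof.
move=> P G DG fG [y [r [r0 yr]]].
pose k : 'I_m.+1 := ord0.
pose y' := col' k y; pose t0 := y ord0 k.
have Ey : y = ins k y' t0 by rewrite ins_col'.
pose v (q : {ffun 'I_m -> rat}) : 'rV[R]_m := \row_i ratr (q i).
pose E q (t : 'rV[R]_1) := exists y', G (v q) (ins k y' (t ord0 ord0)).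
have DG' (V : vectType R) (f : V -> 'rV[R]_m) (g : V -> 'rV[R]_m.+1) :
    defmap D f -> defmap D g -> defset D (fun v => G (f v) (g v)).
  move=> df dg; apply: (defmap_comp_set HD (f := fun v => (f v, g v)) _ DG).
  by definable.
have [q|q [t [s [s0 ts]]]|t] := baire_def HD (E := E) _ _ (\row_ _ t0) r0.
- by apply: defset_ex => //; apply: DG'; definable.
- have [y1 H1] := ts t (ballxx t s0).
  have [|y2 H2] := ts (\row__ (t ord0 ord0 + s / 2)).
    apply/rV_ballP; split => // i; rewrite mxE (ord1 i) opprD addrA subrr sub0r.
    by rewrite normrN gtr0_norm; lra.
  have /(congr1 (fun z : 'rV_m.+1 => z ord0 k)) := fG _ _ _ H1 H2.
  by rewrite !ins_at mxE; lra.
move=> /rV_ballP[_ /(_ ord0)]; rewrite mxE => tr nE.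
have [|||x [s [s0 xs]]] := P (fun x y' => G x (ins k y' (t ord0 ord0))).
- by apply: DG'; definable.
- move=> x y1 y2 H1 H2; have := fG _ _ _ H1 H2.
  by move=> /(congr1 (col' k)); rewrite !col'_ins.
- exists y', r; split => // z yz; apply: yr; rewrite Ey ins_ball; split => //.
have H i : {q | x ord0 i - s < ratr q < x ord0 i + s}.
  by apply: cid; apply: rat_between; lra.
pose q := [ffun i => projT1 (H i)].
have [|z Hz] := xs (v q); last by apply: (nE q); exists z.
apply/rV_ballP; split => // i; rewrite mxE ffunE.
by case: (H i) => /= p /andP[p1 p2]; rewrite ltr_norml; apply/andP; split; lra.
Qed.

(** If the domain had empty interior, [thin_cover] would split it into countably many pieces, each
    described by m of its m + 1 coordinates. By Baire the image of one piece would have interior,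
    against [no_dim_raise_of], which the induction hypothesis makes available in dimension m. *)
Lemma has_interior_domain m (G : 'rV[R]_m -> 'rV[R]_m -> Prop) :
  defset D (fun p : 'rV[R]_m * 'rV[R]_m => G p.1 p.2) -> functional G ->
  has_interior (fun y => exists x, G x y) -> has_interior (fun x => exists y, G x y).
Proof.
elim: m G => [|m IH] G DG fG [y [r [r0 yr]]].
  have [x Gx] := yr y (ballxx y r0); exists x, r; split => // z _; exists y.
  by rewrite (_ : z = x) //; apply/rowP => -[].
have DG' (V : vectType R) (f g : V -> 'rV[R]_m.+1) :
    defmap D f -> defmap D g -> defset D (fun v => G (f v) (g v)).
  move=> df dg; apply: (defmap_comp_set HD (f := fun v => (f v, g v)) _ DG).
  by definable.
apply: contrapT => nE.
have [|T [F [k [DF Finj FE]]]] := thin_cover _ nE.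
  by apply: defset_ex => //; apply: DG'; definable.
have [t|t [y' [s [s0 ys]]]|z] :=
    baire_def HD (E := fun t y => exists x, F t x /\ G x y) _ _ y r0.
- have DFt := DF t; apply: defset_ex => //; apply: defset_and => //.
    by definable.
  by apply: DG'; definable.
- have DFt := DF t.
  have [||] := @no_dim_raise_of m IH (fun x y => exists s : R^o,
      F t (ins (k t) x s) /\ G (ins (k t) x s) y).
  + apply: defset_ex => //; apply: defset_and => //; first by definable.
    by apply: DG'; definable.
  + move=> x y1 y2 [s1 [F1 G1]] [s2 [F2 G2]].
    suff e : ins (k t) x s1 = ins (k t) x s2 by rewrite -e in G2; exact: fG G2.
    apply: (Finj t) => // i; case: (unliftP (k t) i) => [j|] ->.
      by rewrite !ins_lift.
    by rewrite eqxx.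
  + exists y', s; split => // z /ys[x [Fx Gx]].
    by exists (col' (k t) x), (x ord0 (k t)); rewrite ins_col'.
- move=> /yr [x Gx] nF; have [|t Ft] := FE x; first by exists z.
  by apply: (nF t); exists x.
Qed.

End Dimension.

(** * Definable choice and generic continuity *)

Section Generic.
Variables (R : realType) (D : forall n : nat, set (set 'rV[R]_n)).
Hypothesis HD : o_minimal D.

(** The working form of Baire's theorem: a parameter from a countable set, chosen point by point,
    can be made constant on a smaller ball. *)
Lemma baire_pick n (T : countType) (E : T -> set 'rV[R]_n) x r :
  (forall k, defset D (E k)) -> 0 < r ->
  (forall y, ball x r y -> exists k, E k y) ->
  exists k x' r', [/\ 0 < r', ball x' r' `<=` ball x r & ball x' r' `<=` E k].
Proof.
move=> DE r0 xE; apply: contrapT => H.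
have [k|k [x' [r' [r'0 x'r]]]|y xy nE] :=
  baire_def HD (E := fun k y => ball x r y /\ E k y) _ _ x r0.
- by have DEk := DE k; definable.
- by apply: H; exists k, x', r'; split => // y /x'r[].
- by have [k Ek] := xE y xy; apply: (nE k).
Qed.

Lemma ball_pick n (I : finType) (G : I -> set 'rV[R]_n) :
  (forall i x r, 0 < r -> exists x' r',
    [/\ 0 < r', ball x' r' `<=` ball x r & ball x' r' `<=` G i]) ->
  forall x r, 0 < r -> exists x' r',
    [/\ 0 < r', ball x' r' `<=` ball x r & forall i, ball x' r' `<=` G i].
Proof.
move=> HG.
suff H (s : seq I) x r : 0 < r -> exists x' r', [/\ 0 < r',
    ball x' r' `<=` ball x r & forall i, i \in s -> ball x' r' `<=` G i].
  move=> x r r0; have [x' [r' [r'0 xr Hi]]] := H (enum I) x r r0.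
  exists x', r'; split => // i.
  by apply: Hi; rewrite mem_enum.
elim: s x r => [|i s IH] x r r0; first by exists x, r; split.
have [x1 [r1 [r10 xr1 Gi]]] := HG i x r r0.
have [x2 [r2 [r20 xr2 Gs]]] := IH x1 r1 r10.
exists x2, r2; split => //; first exact: subset_trans xr1.
by move=> j; rewrite inE => /orP[/eqP ->|/Gs //]; exact: subset_trans Gi.
Qed.

Lemma defset_rel (V W U : vectType R) (X : W -> U -> Prop) (f : V -> W) (g : V -> U) :
  defset D (fun p : W * U => X p.1 p.2) ->
  defmap D f -> defmap D g -> defset D (fun v => X (f v) (g v)).
Proof.
move=> DX df dg; apply: (defmap_comp_set HD (f := fun v => (f v, g v)) _ DX).
by definable.
Qed.

(** A fiber containing an interval contains a rational; a finite fiber has a point that is alone in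
    some rational window. By [baire_pick] the same rational, or the same window, serves on a whole
    ball, so g is constant or is the unique solution. *)
Lemma choice_line n (X : 'rV[R]_n -> R^o -> Prop) x r :
  defset D (fun p : 'rV[R]_n * R^o => X p.1 p.2) -> 0 < r ->
  (forall y, ball x r y -> exists t, X y t) ->
  exists x' r' (g : 'rV[R]_n -> R^o), [/\ 0 < r', ball x' r' `<=` ball x r,
    defmap D g & forall y, ball x' r' y -> X y (g y)].
Proof.
move=> DX r0 xX.
pose I (q : rat * rat) y (t : R^o) :=
  X y t /\ ((ratr q.1 < t :> R) /\ (t < ratr q.2 :> R)).
pose E (q : rat + rat * rat) y := match q with
  | inl q => X y (ratr q : R)
  | inr q => exists t : R^o, I q y t /\ forall t' : R^o, I q y t' -> t' = t
  end.
have DI q : defset D (fun p : 'rV[R]_n * R^o => I q p.1 p.2).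
  by rewrite /I; apply: defset_and => //; definable.
have [q||y /xX[t Xt]|q [x' [r' [r'0 xr xE]]]] := @baire_pick n _ E x r.
- case: q => [q|q]; rewrite /E; first by apply: defset_rel => //; definable.
  apply: defset_ex => //; apply: defset_and => //.
  apply: defset_all => //; apply: defset_imp => //; last by definable.
  by apply: (defset_rel (DI q)); definable.
- by [].
- have DS : defset D (fun t => X y t) by apply: (defset_rel DX); definable.
  have [[u [v [uv Huv]]]|[s Hs]] := defset_line_finite HD DS.
    by have [q qq] := rat_between uv; exists (inl q); apply: Huv.
  have [d d0 Hd] := finite_isolated s t.
  have [|q /andP[q1 q2]] := @rat_between R (t - d) t; first by rewrite ltrBlDr ltrDl.
  have [|q' /andP[q1' q2']] := @rat_between R t (t + d); first by rewrite ltrDl.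
  exists (inr (q, q')), t; split; first by split.
  move=> t' [/Hs/Hd Xt'] /= [h1 h2]; apply: Xt'.
  by rewrite ltr_norml; apply/andP; split; lra.
- case: q xE => [q|q] xE.
    exists x', r', (fun _ => ratr q : R); split => //; first exact: defmap_cst.
  (* Off the ball the value is set to 0, so that [Y] is the graph of a total function, as [defmap]
     demands. *)
  pose Y y t := (ball x' r' y /\ I q y t) \/ (~ ball x' r' y /\ t = 0 :> R^o).
  have Yex y : exists t, Y y t.
    have [/[dup] yb /xE[t [It _]]|yb] := pselect (ball x' r' y).
      by exists t; left.
    by exists 0; right.
  exists x', r', (fun y => xget 0 (Y y)); split => //.
    apply: (defset_ext (X := fun p => Y p.1 p.2)) => [[y t]|] /=.
      split=> [Yt|->]; last by have [t' Yt'] := Yex y; apply: (xgetI _ Yt').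
      have Yg : Y y (xget 0 (Y y)) by apply: (xgetI _ Yt).
      case: Yt => -[yb It]; case: Yg => -[yb' It'] //; last by rewrite It It'.
      have [t0 [_ Ht0]] := xE y yb.
      by rewrite (Ht0 _ It) (Ht0 _ It').
    by have DIq := DI q; rewrite /Y; definable.
  move=> y yb; have [t Yt] := Yex y.
  have : Y y (xget 0 (Y y)) by apply: (xgetI _ Yt).
  by case => [[_ []]|[]].
Qed.

Lemma definable_choice n m (X : 'rV[R]_n -> 'rV[R]_m -> Prop) x r :
  defset D (fun p : 'rV[R]_n * 'rV[R]_m => X p.1 p.2) -> 0 < r ->
  (forall y, ball x r y -> exists t, X y t) ->
  exists x' r' (g : 'rV[R]_n -> 'rV[R]_m),
    [/\ 0 < r', ball x' r' `<=` ball x r,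
    defmap D g & forall y, ball x' r' y -> X y (g y)].
Proof.
elim: m X x r => [|m IH] X x r DX r0 xX.
  exists x, r, (fun _ => 0); split => //; first exact: defmap_cst.
  move=> y /xX[t Xt]; rewrite (_ : 0 = t) //; by apply/rowP => -[].
have [||y /xX[t Xt]|x1 [r1 [g1 [r10 xr1 Dg1 Hg1]]]] :=
    @choice_line n (fun y t => exists w, X y (ins ord0 w t)) x r.
- by apply: defset_ex => //; apply: (defset_rel DX); definable.
- by [].
- by exists (t ord0 ord0), (col' ord0 t); rewrite ins_col'.
have [|||x2 [r2 [g2 [r20 xr2 Dg2 Hg2]]]] :=
  IH (fun y w => X y (ins ord0 w (g1 y))) x1 r1.
- by apply: (defset_rel DX); definable.
- by [].
- exact: Hg1.
exists x2, r2, (fun y => ins ord0 (g2 y) (g1 y)); split => //.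
- exact: subset_trans xr1.
- by definable.
Qed.

(** Continuity with its quantifiers over [R^o] made explicit, so that it is visibly first-order;
    [cont_atP] relates it to the topological notion. *)
Definition cont_at n (h : 'rV[R]_n -> R) y := forall e : R^o, (0 < e :> R) ->
  exists d : R^o, (0 < d :> R) /\ forall z, ball y d z -> `|h z - h y| < e.

(** At a discontinuity y, some rational q separates [h y] from values of h taken arbitrarily near y.
    For a fixed q and a fixed side this cannot hold throughout a ball, since those nearby points
    would lie on the same side of q as y. Baire then excludes a ball of discontinuities. *)
Lemma generic_continuity n (h : 'rV[R]_n -> R^o) x r : defmap D h -> 0 < r ->
  exists x' r', [/\ 0 < r', ball x' r' `<=` ball x r &
    ball x' r' `<=` cont_at h].
Proof.
move=> Dh r0.
have Dc : defset D (cont_at h : set 'rV[R]_n) by rewrite /cont_at; definable.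
have [|y [s [s0 ys H]]] := ndense_all HD (defset_not HD Dc) _ x r0; last first.
  by exists y, s; split => // z /H/contrapT.
move=> [{r0}x' [{}r [r0 xr]]].
pose E (q : bool * rat) y := if q.1
  then (h y < ratr q.2 :> R) /\
    forall d : R^o, 0 < d :> R -> exists z, ball y d z /\ (ratr q.2 < h z :> R)
  else (ratr q.2 < h y :> R) /\
    forall d : R^o, 0 < d :> R -> exists z, ball y d z /\ (h z < ratr q.2 :> R).
have [||y /xr nc nE] := baire_def HD (E := E) _ _ x' r0.
- by move=> [[] q]; rewrite /E /=; definable.
- move=> q [y [s [s0 ys]]]; case: q ys => -[] q ys; rewrite /E /= in ys.
    have [_ /(_ s s0)[z [yz qz]]] := ys y (ballxx y s0).
    by have [zq _] := ys z yz; have := lt_trans zq qz; rewrite ltxx.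
  have [_ /(_ s s0)[z [yz qz]]] := ys y (ballxx y s0).
  by have [zq _] := ys z yz; have := lt_trans zq qz; rewrite ltxx.
apply: nc => e e0.
have H1 : exists2 d, 0 < d & forall z, ball y d z -> h z < h y + e :> R.
  have [|q /andP[q1 q2]] := @rat_between R (h y) (h y + e); first by rewrite ltrDl.
  apply: contrapT => H; apply: (nE (true, q)); split => // d d0.
  apply: contrapT => K; apply: H; exists d => // z yz.
  rewrite ltNge; apply/negP => hz; apply: K; exists z; split => //.
  exact: lt_le_trans hz.
have H2 : exists2 d, 0 < d & forall z, ball y d z -> h y - e < h z :> R.
  have [|q /andP[q1 q2]] := @rat_between R (h y - e) (h y).
    by rewrite ltrBlDr ltrDl.
  apply: contrapT => H; apply: (nE (false, q)); split => // d d0.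
  apply: contrapT => K; apply: H; exists d => // z yz.
  rewrite ltNge; apply/negP => hz; apply: K; exists z; split => //.
  exact: le_lt_trans hz _.
have [d d0 Hd] := H1; have [d' d'0 Hd'] := H2.
exists (Num.min d d'); split; first by rewrite lt_min d0.
move=> z yz; have h1 := Hd z (le_ball (min_lel _ _) yz).
have h2 := Hd' z (le_ball (min_ler _ _) yz).
by rewrite ltr_norml; apply/andP; split; [rewrite ltrBrDr addrC|rewrite ltrBlDr addrC].
Qed.

End Generic.

(** * Generic smoothness *)

Section RightDerivative.
Variables (R : realType).

(** The supremum of the points x with [phi a <= phi x] is such a point by continuity; if it were
    less than b, growth to the right would produce a larger one. *)
Lemma right_nondecreasing (phi : R -> R) a b : a <= b ->
  (forall x, a <= x <= b -> {for x, continuous phi}) ->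
  (forall x, a <= x < b -> exists2 d, 0 < d &
     forall t, 0 < t < d -> phi x <= phi (x + t)) ->
  phi a <= phi b.
Proof.
move=> ab phic H; pose S := [set x | a <= x <= b /\ phi a <= phi x].
have Sa : S a by rewrite /S /= lexx ab.
have supS : has_sup S by split; [exists a|exists b => x [/andP[]]].
have as_ : a <= sup S by apply: ub_le_sup => //; case: supS.
have sb : sup S <= b by apply: ge_sup; [exists a|move=> x [/andP[]]].
have Ss : phi a <= phi (sup S).
  rewrite leNgt; apply/negP => sa.
  have := phic (sup S); rewrite as_ sb => /(_ isT).
  move=> /cvgrPdist_lt /(_ (phi a - phi (sup S))).
  rewrite subr_gt0 => /(_ sa) /nbhs_ballP[d d0 Hd].
  have [x Sx dx] := sup_adherent d0 supS.
  have xs : x <= sup S by apply: ub_le_sup => //; case: supS.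
  have /= := Hd x; rewrite /ball /= ger0_norm ?subr_ge0 //.
  have -> : sup S - x < d by lra.
  move=> /(_ isT); rewrite ltr_norml => /andP[h _].
  by case: Sx => _; lra.
move: sb; rewrite le_eqVlt => /orP[/eqP <- //|sb].
have [|d d0 Hd] := H (sup S); first by rewrite as_.
pose t := Num.min d (b - sup S) / 2.
have t0 : 0 < t by rewrite divr_gt0 // lt_min d0 subr_gt0.
have td : t < d by have := min_lel d (b - sup S); rewrite /t; lra.
have tb : t < b - sup S by have := min_ler d (b - sup S); rewrite /t; lra.
have : sup S + t <= sup S.
  apply: ub_le_sup; first by case: supS.
  split; first by apply/andP; split; lra.
  by apply: le_trans Ss _; apply: Hd; rewrite t0.
lra.
Qed.

Lemma right_slope (phi : R -> R) c a b : a <= b ->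
  (forall x, a <= x <= b -> {for x, continuous phi}) ->
  (forall x, a <= x < b -> exists2 d, 0 < d &
     forall t, 0 < t < d -> c * t <= phi (x + t) - phi x) ->
  c * (b - a) <= phi b - phi a.
Proof.
move=> ab phic H.
suff : phi a - c * a <= phi b - c * b by lra.
apply: (right_nondecreasing (phi := fun x => phi x - c * x)) => //.
  move=> x xab; apply: cvgB; first exact: phic.
  by apply: cvgM; [exact: cvg_cst|exact: cvg_id].
move=> x /H[d d0 Hd]; exists d => // t /Hd; lra.
Qed.

Variable n : nat.
Implicit Types (h : 'rV[R]_n -> R) (x y : 'rV[R]_n).
Local Notation e_ j := (delta_mx ord0 j : 'rV[R]_n).

Lemma ball_segment x r y j t s : ball x r y -> ball x r (y + t *: e_ j) ->
  0 <= s <= t -> ball x r (y + s *: e_ j).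
Proof.
move=> /rV_ballP[r0 H0] /rV_ballP[_ Ht] /andP[s0 st].
apply/rV_ballP; split => // i; have := H0 i; have := Ht i.
rewrite !mxE !eqxx /=; case: eqP => _ /=; rewrite ?(mulr1, mulr0) ?addr0 //.
by rewrite !ltr_norml => /andP[h1 h2] /andP[h3 h4]; apply/andP; split; lra.
Qed.

Lemma cont_at_line h y j s : cont_at h (y + s *: e_ j) ->
  {for s, continuous (fun t : R => h (y + t *: e_ j))}.
Proof.
move=> hc; apply/cvgrPdist_lt => e e0; have [d [d0 Hd]] := hc e e0.
apply/nbhs_ballP; exists d => // t /= st; rewrite distrC; apply: Hd.
apply/rV_ballP; split => // i; rewrite !mxE opprD addrACA subrr add0r -mulrBl.
rewrite normrM; apply: le_lt_trans st; rewrite ler_piMr //.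
by rewrite !eqxx /=; case: eqP; rewrite ?normr1 ?normr0.
Qed.

Lemma slope_ball h j c x r :
  (forall y, ball x r y -> cont_at h y) ->
  (forall y, ball x r y -> exists2 d, 0 < d &
    forall t, 0 < t < d -> c * t <= h (y + t *: e_ j) - h y) ->
  forall y t, 0 <= t -> ball x r y -> ball x r (y + t *: e_ j) ->
    c * t <= h (y + t *: e_ j) - h y.
Proof.
move=> hc Hc y t t0 xy xyt.
have := @right_slope (fun s => h (y + s *: e_ j)) c 0 t t0.
rewrite subr0 scale0r addr0; apply.
  by move=> s st; apply: cont_at_line; apply: hc; exact: (ball_segment xy xyt).
move=> s /andP[s0 st].
have [|d d0 Hd] := Hc (y + s *: e_ j).
  by apply: (ball_segment xy xyt); rewrite s0 ltW.
by exists d => // u /Hd; rewrite -addrA -scalerDl.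
Qed.

(** Right partial derivative in direction j, written without division to stay within the definable
    operations. *)
Definition is_rd h j y (p : R^o) := forall e : R^o, (0 < e :> R) ->
  exists d : R^o, (0 < d :> R) /\ forall t : R^o, (0 < t :> R) /\ (t < d :> R) ->
   (`|h (y + t *: e_ j) - h y - t * p| <= e * t :> R).

(* The right partial derivative; junk value 0 where there is none. Right
   derivatives suffice for C^1 since, when continuous, they control increments
   on both sides. *)
Definition rd h j y : R^o := xget 0 (is_rd h j y).

Lemma is_rd_unique h j y p q : is_rd h j y p -> is_rd h j y q -> p = q.
Proof.
move=> Hp Hq; apply/eqP; rewrite -subr_eq0 -normr_eq0; apply/negPn/negP => pq.
have e0 : 0 < `|p - q| / 4 by rewrite divr_gt0 // lt_def pq normr_ge0.
have [d1 [d10 H1]] := Hp _ e0; have [d2 [d20 H2]] := Hq _ e0.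
pose t := Num.min d1 d2 / 2.
have t0 : 0 < t by rewrite divr_gt0 // lt_min d10 d20.
have t1 : t < d1 by have := min_lel d1 d2; rewrite /t; lra.
have t2 : t < d2 by have := min_ler d1 d2; rewrite /t; lra.
have {}H1 := H1 t (conj t0 t1); have {}H2 := H2 t (conj t0 t2).
set A := h _ - h _ in H1 H2.
have : `|p - q| * t <= `|p - q| / 4 * t + `|p - q| / 4 * t.
  apply: le_trans (lerD H2 H1); rewrite -[t in `|p - q| * t]gtr0_norm // -normrM.
  have -> : (p - q) * t = (A - t * q) - (A - t * p) by rewrite /=; ring.
  exact: ler_normB.
have pt : 0 < `|p - q| * t by rewrite mulr_gt0 // lt_def pq normr_ge0.
move: pt; set u := `|p - q|; lra.
Qed.

End RightDerivative.

Section GenericC1.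
Variables (R : realType) (D : forall n : nat, set (set 'rV[R]_n)).
Hypothesis HD : o_minimal D.
Variable n : nat.
Local Notation e_ j := (delta_mx ord0 j : 'rV[R]_n).

Lemma is_rd_rd (h : 'rV[R]_n -> R) j y p : is_rd h j y p -> is_rd h j y (rd h j y).
Proof. by move=> H; apply: (xgetI _ H). Qed.

Lemma defmap_rd (h : 'rV[R]_n -> R^o) j : defmap D h -> defmap D (rd h j).
Proof.
move=> Dh; apply: (defset_ext (X := fun p : 'rV[R]_n * R^o => is_rd h j p.1 p.2 \/
  (~ (exists q, is_rd h j p.1 q) /\ p.2 = 0))).
  move=> [y p] /=; split.
    move=> [H|[H ->]]; first exact: is_rd_unique H (is_rd_rd H).
    rewrite /rd; case: xgetP => // q _ Hq; case: H; by exists q.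
  move=> ->; have [[q Hq]|H] := pselect (exists q, is_rd h j y q).
    by left; exact: is_rd_rd Hq.
  right; split => //; rewrite /rd; case: xgetP => // q _ Hq.
  by case: H; exists q.
by rewrite /is_rd; definable.
Qed.

(* By o-minimality the difference quotient is eventually on one side of every
   threshold c, so it has a limit in [-oo, +oo]. *)
Lemma rd_trichotomy (h : 'rV[R]_n -> R^o) j y : defmap D h ->
  [\/ exists p, is_rd h j y p,
    forall c : R, exists2 d : R, 0 < d &
      forall t, 0 < t < d -> c * t <= h (y + t *: e_ j) - h y |
    forall c : R, exists2 d : R, 0 < d &
      forall t, 0 < t < d -> h (y + t *: e_ j) - h y <= c * t].
Proof.
move=> Dh.
pose C := [set c : R | exists2 d : R, 0 < d &
  forall t, 0 < t < d -> c * t <= h (y + t *: e_ j) - h y].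
have nC c : ~ C c -> exists2 d : R, 0 < d &
  forall t, 0 < t < d -> h (y + t *: e_ j) - h y <= c * t.
  move=> ncC.
  have DS : defset D (fun t : R^o => (c * t <= h (y + t *: e_ j) - h y :> R)).
    by definable.
  have [d d0 [H|H]] := defset_line_right HD 0 DS.
    by case: ncC; exists d => // t; have := H t; rewrite add0r.
  exists d => // t td; have := H t; rewrite add0r => /(_ td) /negP.
  by rewrite -ltNge => /ltW.
have [CT|/existsNP[c1 nc1]] := pselect (forall c, C c); first exact: Or32.
have [C0|/existsNP[c0 /contrapT cc0]] := pselect (forall c, ~ C c).
  by apply: Or33 => c; apply: nC.
have ub c : C c -> c <= c1.
  move=> [d d0 Hd]; have [d' d'0 Hd'] := nC _ nc1.
  pose t := Num.min d d' / 2.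
  have t0 : 0 < t by rewrite divr_gt0 // lt_min d0 d'0.
  have t1 : t < d by have := min_lel d d'; rewrite /t; lra.
  have t2 : t < d' by have := min_ler d d'; rewrite /t; lra.
  have := le_trans (Hd t _) (Hd' t _); rewrite t0 t1 t2 => /(_ isT isT).
  by rewrite ler_pM2r.
have supC : has_sup C by split; [exists c0|exists c1 => c /ub].
apply: Or31; exists (sup C) => e e0.
have [c [d d0 Hd] ce] := sup_adherent e0 supC.
have [|d' d'0 Hd'] := nC (sup C + e).
  move=> Ce; have : sup C + e <= sup C by apply: ub_le_sup => //; case: supC.
  by rewrite gerDl leNgt e0.
exists (Num.min d d'); split; first by rewrite lt_min d0.
move=> t []; rewrite lt_min => t0 /andP[t1 t2].
have := Hd t; have := Hd' t; rewrite t0 t1 t2 => /(_ isT) h1 /(_ isT) h2.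
have h3 : (sup C - e) * t <= c * t by rewrite ler_pM2r // ltW.
by rewrite ler_norml; apply/andP; split; lra.
Qed.

Lemma cont_at_opp (h : 'rV[R]_n -> R) y : cont_at h y -> cont_at (fun z => - h z) y.
Proof.
move=> H e /H[d [d0 Hd]]; exists d; split => // z /Hd.
by rewrite -opprD normrN.
Qed.

Lemma no_infinite_slope (h : 'rV[R]_n -> R) j x r : 0 < r ->
  (forall y, ball x r y -> cont_at h y) ->
  ~ (forall y, ball x r y -> forall c : R, exists2 d : R, 0 < d &
    forall t, 0 < t < d -> c * t <= h (y + t *: e_ j) - h y).
Proof.
move=> r0 hc H; have r2 : 0 < r / 2 by rewrite divr_gt0.
pose z := x + (r / 2) *: e_ j.
have xz : ball x r z.
  apply/rV_ballP; split => // i; rewrite !mxE opprD addrA subrr add0r normrN.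
  rewrite normrM eqxx /=; apply: (@le_lt_trans _ _ (r / 2)); last by lra.
  rewrite (gtr0_norm r2) ler_piMr ?(ltW r2) //.
  by case: eqP; rewrite ?normr1 ?normr0.
have xx : ball x r x by apply: ballxx.
(* With this slope, the increment from x to z would be at least [h z - h x + 1]. *)
pose c := (h z - h x + 1) / (r / 2).
have := @slope_ball _ _ h j c x r hc (fun y xy => H y xy c) x (r / 2) (ltW r2) xx xz.
rewrite /c divfK ?gt_eqF // -/z; lra.
Qed.

(** The three cases of [rd_trichotomy] are definable, so one of them holds on a whole ball. An
    infinite slope on a ball is excluded, and [rd] is itself a definable function, hence continuous
    on a smaller ball. *)
Lemma generic_rd (h : 'rV[R]_n -> R^o) j x r : defmap D h -> 0 < r ->
  (forall y, ball x r y -> cont_at h y) ->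
  exists x' r', [/\ 0 < r', ball x' r' `<=` ball x r &
    forall y, ball x' r' y -> is_rd h j y (rd h j y) /\ cont_at (rd h j) y].
Proof.
move=> Dh r0 hc.
pose E (i : option bool) y := match i with
  | None => exists p, is_rd h j y p
  | Some true => forall c : R^o, exists d : R^o, (0 < d :> R) /\ forall t : R^o,
     (0 < t :> R) /\ (t < d :> R) -> (c * t <= h (y + t *: e_ j) - h y :> R)
  | Some false => forall c : R^o, exists d : R^o, (0 < d :> R) /\ forall t : R^o,
     (0 < t :> R) /\ (t < d :> R) -> (h (y + t *: e_ j) - h y <= c * t :> R)
  end.
have [i|y xy|i [x1 [r1 [r10 xr1 HE]]]] := baire_pick HD (E := E) (x := x) _ r0.
- by case: i => [[]|]; rewrite /E /is_rd; definable.
- have [H|H|H] := rd_trichotomy j y Dh; first by exists None.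
    exists (Some true) => c; have [d d0 Hd] := H c; exists d; split => // t /andP.
    exact: Hd.
  exists (Some false) => c; have [d d0 Hd] := H c; exists d; split => // t /andP.
  exact: Hd.
case: i HE => [[]|] HE.
- have := @no_infinite_slope h j x1 r1 r10 (fun y xy => hc y (xr1 _ xy)).
  case=> y /HE H c; have [d [d0 Hd]] := H c; exists d => // t /andP; exact: Hd.
- have := @no_infinite_slope (fun z => - h z) j x1 r1 r10
    (fun y xy => cont_at_opp (hc y (xr1 _ xy))).
  case=> y /HE H c; have [d [d0 Hd]] := H (- c); exists d => // t /andP /Hd; lra.
have [x2 [r2 [r20 xr2 H2]]] := generic_continuity HD x1 (defmap_rd j Dh) r10.
exists x2, r2; split => //; first exact: subset_trans xr1.
move=> y xy; split; last exact: H2.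
by have [p Hp] := HE _ (xr2 _ xy); exact: is_rd_rd Hp.
Qed.

(** A mean value inequality from right derivatives alone: [slope_ball] is applied to h and to its
    opposite, and a negative t exchanges the endpoints. The factor 2 adds the error in [is_rd] to
    the distance from [rd] to p. *)
Lemma rd_increment (h : 'rV[R]_n -> R) j (p e : R) x r : 0 < e ->
  (forall y, ball x r y -> cont_at h y) ->
  (forall y, ball x r y -> is_rd h j y (rd h j y) /\ `|rd h j y - p| < e) ->
  forall y t, ball x r y -> ball x r (y + t *: e_ j) ->
    `|h (y + t *: e_ j) - h y - t * p| <= 2 * e * `|t|.
Proof.
move=> e0 hc H.
suff K y t : 0 <= t -> ball x r y -> ball x r (y + t *: e_ j) ->
    `|h (y + t *: e_ j) - h y - t * p| <= 2 * e * t.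
  move=> y t xy xyt; have [t0|t0] := leP 0 t; first by rewrite (ger0_norm t0) K.
  have := K (y + t *: e_ j) (- t); rewrite -addrA -scalerDl subrr scale0r addr0.
  rewrite oppr_ge0 => /(_ (ltW t0) xyt xy).
  rewrite (ltr0_norm t0) -[X in _ -> X <= _]normrN; congr (`|_| <= _); ring.
move=> t0 xy xyt.
have Hs (y' : 'rV[R]_n) : ball x r y' -> exists2 d, 0 < d & forall t, 0 < t < d ->
    `|h (y' + t *: e_ j) - h y' - t * p| <= 2 * e * t.
  move=> /H[Hrd pe]; have [d [d0 Hd]] := Hrd e e0.
  exists d => // u /[dup] /andP[u0 _] /andP /Hd Hu.
  have -> : h (y' + u *: e_ j) - h y' - u * p =
    (h (y' + u *: e_ j) - h y' - u * rd h j y') + u * (rd h j y' - p) by ring.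
  rewrite (le_trans (ler_normD _ _)) // normrM (gtr0_norm u0).
  have : u * `|rd h j y' - p| <= u * e by rewrite ler_pM2l // ltW.
  by move: Hu; set A := `|_|; lra.
have h1 := @slope_ball _ _ h j (p - 2 * e) x r hc.
have {}h1 := h1 _ y t t0 xy xyt.
have h2 := @slope_ball _ _ (fun z => - h z) j (- p - 2 * e) x r.
have {}h2 := h2 (fun y xy => cont_at_opp (hc y xy)) _ y t t0 xy xyt.
have /h1{}h1 : forall y', ball x r y' -> exists2 d, 0 < d &
    forall t, 0 < t < d -> (p - 2 * e) * t <= h (y' + t *: e_ j) - h y'.
  move=> y' /Hs[d d0 Hd]; exists d => // u /Hd.
  by rewrite ler_norml => /andP[]; lra.
have /h2{}h2 : forall y', ball x r y' -> exists2 d, 0 < d &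
    forall t, 0 < t < d ->
      (- p - 2 * e) * t <= - h (y' + t *: e_ j) - - h y'.
  move=> y' /Hs[d d0 Hd]; exists d => // u /Hd.
  by rewrite ler_norml => /andP[]; lra.
by rewrite ler_norml; apply/andP; split; lra.
Qed.

End GenericC1.

Lemma fin_min (R : realType) (I : finType) (P : I -> R -> Prop) :
  (forall i d d', 0 < d' -> d' <= d -> P i d -> P i d') ->
  (forall i, exists2 d, 0 < d & P i d) -> exists2 d, 0 < d & forall i, P i d.
Proof.
move=> mono HP.
suff [d d0 Hd] : exists2 d, 0 < d & forall i, i \in enum I -> P i d.
  by exists d => // i; apply: Hd; rewrite mem_enum.
elim: (enum I) => [|i s [d d0 IH]]; first by exists 1.
have [d' d'0 Hi] := HP i; exists (Num.min d d'); first by rewrite lt_min d0.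
move=> j; rewrite inE => /orP[/eqP ->|/IH].
  by apply: mono Hi; rewrite ?lt_min ?d0 ?min_ler.
by apply: mono; rewrite ?lt_min ?d0 ?min_lel.
Qed.

Lemma lin1_mxE (R : pzSemiRingType) m n (g : 'rV[R]_m -> 'rV[R]_n) i j :
  lin1_mx g i j = g (delta_mx ord0 i) ord0 j.
Proof. by rewrite mxE. Qed.

(** * Coordinatewise norm and convergence *)

Section Norm.
Variables (R : realType) (n : nat).

Lemma rV_norm_leP (v : 'rV[R]_n) s : 0 <= s ->
  (`|v| <= s) <-> forall k, `|v ord0 k| <= s.
Proof.
move=> s0; rewrite [`|v|](mx_normrE v); split => [H k|H].
  by apply: le_trans H; apply: (le_bigmax _ (fun i => `|v i.1 i.2|) (ord0, k)).
by apply: bigmax_le => // -[i k] _ /=; rewrite ord1.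
Qed.

Lemma rV_norm_coord (v : 'rV[R]_n) k : `|v ord0 k| <= `|v|.
Proof. by have /rV_norm_leP := lexx `|v|; apply. Qed.

Lemma cvg_rV (T : Type) (F : set_system T) (FF : Filter F) (g : T -> 'rV[R]_n)
    (l : 'rV[R]_n) :
  (forall i, (fun t => g t ord0 i) @ F --> l ord0 i) -> g @ F --> l.
Proof.
move=> H; apply/cvgrPdist_le => e e0.
have : \forall t \near F, forall i, `|l ord0 i - g t ord0 i| <= e.
  by apply: filter_forall => i; have /cvgrPdist_le := H i; apply.
apply: filterS => t Ht; apply/rV_norm_leP; first exact: ltW.
by move=> k; have := Ht k; rewrite !mxE.
Qed.

Lemma cvg_sum_fin (T : Type) (F : set_system T) (FF : Filter F) (I : finType)
    (g : I -> T -> R) (l : I -> R) :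
  (forall i, g i @ F --> l i) -> (fun t => \sum_i g i t) @ F --> \sum_i l i.
Proof.
move=> H; rewrite unlock /=.
elim: (index_enum I) => [|i s IH] /=; first exact: cvg_cst.
exact: cvgD.
Qed.

Lemma cont_atP (h : 'rV[R]_n -> R) y : cont_at h y <-> {for y, continuous h}.
Proof.
have P := @cvgrPdist_lt _ _ _ (nbhs y) (nbhs_filter y) h (h y).
split => [H|/P H].
  apply/P => e e0; have [d [d0 Hd]] := H e e0.
  by apply/nbhs_ballP; exists d => // z /= /Hd; rewrite distrC.
move=> e /H /nbhs_ballP[d d0 Hd]; exists d; split => // z /Hd /=.
by rewrite distrC.
Qed.

End Norm.

(** * Differentiability and class C^1 in first-order terms *)

Section Differential.
Variables (R : realType) (n m : nat).
Implicit Types (f : 'rV[R]_n -> 'rV[R]_m) (x : 'rV[R]_n).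

(* A first-order form of differentiability with Jacobian J. The condition
   [0 <= s] matters when n = 0 only. *)
Definition is_jac f x (J : 'M[R]_(n, m)) := forall e : R^o, (0 < e :> R) ->
  exists d : R^o, (0 < d :> R) /\ forall (s : R^o) (v : 'rV[R]_n),
   (forall k, (`|v ord0 k| <= s :> R)) /\ ((0 <= s :> R) /\ (s < d :> R)) ->
   forall i,
   (`|f (x + v) ord0 i - f x ord0 i - (\sum_k v ord0 k * J k i)| <= e * s :> R).

Lemma mulmxr_continuous (J : 'M[R]_(n, m)) :
  continuous (mulmxr J : 'rV[R]_n -> 'rV[R]_m).
Proof.
move=> v; apply: (cvg_rV (nbhs_filter v)) => i.
rewrite [X in _ --> X]/= mxE.
have -> : (fun t : 'rV[R]_n => mulmxr J t ord0 i) =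
  (fun t => \sum_k t ord0 k * J k i) by apply/funext => t; rewrite /= mxE.
apply: (cvg_sum_fin (nbhs_filter v)) => k; apply: cvgM; last exact: cvg_cst.
exact: coord_continuous.
Qed.

Lemma is_jac_diff f x J : is_jac f x J -> differentiable f x /\ jacobian f x = J.
Proof.
move=> H.
have E : f \o shift x = cst (f x) + mulmxr J +o_ 0 id.
  apply/eqaddoP => e e0; have [d [d0 Hd]] := H e e0.
  apply/nbhs_ballP; exists d => // v; rewrite -ball_normE /ball_ /= sub0r normrN => vd.
  apply/rV_norm_leP; first by rewrite mulr_ge0 // ltW.
  move=> k; have := Hd `|v| v (conj (rV_norm_coord v) (conj (normr_ge0 v) vd)) k.
  have -> : x + v = v + x by exact: addrC.
  by rewrite [(_ - _) v]/(f (v + x) - (f x + v *m J)) !mxE opprD addrA.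
have dE := diff_unique (mulmxr_continuous (J := J)) E.
split.
  by apply/diff_locallyP; rewrite dE; split => //; exact: mulmxr_continuous.
apply/row_matrixP => i; rewrite /jacobian rowE mul_rV_lin1.
by rewrite dE /= rowE.
Qed.

Lemma diff_is_jac f x : differentiable f x -> is_jac f x (jacobian f x).
Proof.
move=> /diff_locallyP[_ /eqaddoP H] e e0.
have /nbhs_ballP[d d0 Hd] := H e e0; exists d; split => // s v [vs [s0 sd]] i.
have vns : `|v| <= s by apply/rV_norm_leP.
have := Hd v; rewrite -ball_normE /ball_ /= sub0r normrN.
move=> /(_ (le_lt_trans vns sd)) K.
apply: le_trans (_ : e * `|v| <= _); last by rewrite ler_pM2l.
apply: le_trans K.
have -> : \sum_k v ord0 k * 'J f x k i = 'd f x v ord0 i.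
  by rewrite -mul_rV_lin1 mxE.
apply: le_trans (rV_norm_coord _ i).
have -> : x + v = v + x by exact: addrC.
by rewrite [(_ - _) v]/(f (v + x) - (f x + 'd f x v)) !mxE opprD addrA.
Qed.

Lemma is_jacP f x J : is_jac f x J <-> differentiable f x /\ jacobian f x = J.
Proof.
split; first exact: is_jac_diff.
by move=> [df <-]; exact: diff_is_jac.
Qed.

Lemma is_jac_congr f g (U : set 'rV[R]_n) x J : open U -> U x ->
  (forall y, U y -> f y = g y) -> is_jac f x J -> is_jac g x J.
Proof.
move=> Uo Ux fg H e e0; have [d [d0 Hd]] := H e e0.
have /nbhs_ballP[r r0 xr] : nbhs x U by exact: open_nbhs_nbhs.
exists (Num.min d r); split; first by rewrite lt_min d0.
move=> s v [vs [s0]]; rewrite lt_min => /andP[sd sr] i.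
rewrite -!fg //; first exact: Hd.
apply: xr; apply/rV_ballP; split => // k; rewrite mxE opprD addrA subrr add0r.
by rewrite normrN (le_lt_trans (vs k)).
Qed.

(** The existence of Jacobians near x is not part of the condition at x; it comes from imposing the
    condition at all points of an open set, as in [Ck1P]. *)
Definition jac_cont f x := exists J, is_jac f x J /\ forall e : R^o, (0 < e :> R) ->
  exists d : R^o, (0 < d :> R) /\ forall z J', ball x d z -> is_jac f z J' ->
    forall i j, (`|J' i j - J i j| < e :> R).

(** Continuity of the differential in every direction v reduces to the finitely many basis
    directions, that is, to the entries of the Jacobian. *)
Lemma Ck1P f (U : set 'rV[R]_n) : open U ->
  Ck 1 U f <-> forall x, U x -> jac_cont f x.
Proof.
move=> Uo; split.
  move=> [df cf] x Ux; exists (jacobian f x); split; first exact/diff_is_jac/df.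
  move=> e e0; have [d d0 Hd] : exists2 d, 0 < d & forall i z, ball x d z ->
      `|'d f z (delta_mx ord0 i) - 'd f x (delta_mx ord0 i)| < e.
    apply: (fin_min (P := fun i d => forall z, ball x d z ->
      `|'d f z (delta_mx ord0 i) - 'd f x (delta_mx ord0 i)| < e)).
      by move=> i d d' _ dd' H z xz; apply: H; exact: le_ball xz.
    move=> i.
    have /cvgrPdist_lt/(_ e e0)/nbhs_ballP[d d0 Hd] := cf (delta_mx ord0 i) x Ux.
    exists d; first exact: d0.
    by move=> z /Hd K; rewrite distrC; exact: K.
  exists d; split => // z J' xz /is_jacP[_ <-] i j.
  have K (a b : R) (u w : 'rV[R]_m) : a = u ord0 j -> b = w ord0 j ->
      `|u - w| < e -> `|a - b| < e.
    move=> -> ->; apply: le_lt_trans.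
    by have := rV_norm_coord (u - w) j; rewrite !mxE.
  exact: (K _ _ _ _ (lin1_mxE _ _ _) (lin1_mxE _ _ _) (Hd i z xz)).
move=> H; split => [x Ux|v x Ux].
  by have [J [/is_jacP[]]] := H x Ux.
have [J [HJ HcJ]] := H x Ux; apply: (cvg_rV (nbhs_filter x)) => i.
have dE (y : 'rV_n) : 'd f y v ord0 i = \sum_k v ord0 k * jacobian f y k i.
  by rewrite -mul_rV_lin1 mxE.
have K (g1 g2 : 'rV[R]_n -> R) (a b : R) : (forall t, g2 t = g1 t) -> b = a ->
    g1 t @[t --> x] --> a -> g2 t @[t --> x] --> b.
  by move=> /funext -> ->.
apply: (K _ _ _ _ dE (dE x)) => {K}.
apply: (cvg_sum_fin (nbhs_filter x)) => k; apply: cvgM; first exact: cvg_cst.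
apply/(@cvgrPdist_lt _ _ _ _ (nbhs_filter x)) => e e0; have [d [d0 Hd]] := HcJ e e0.
have /nbhs_ballP[r r0 xr] : nbhs x U by exact: open_nbhs_nbhs.
apply/nbhs_ballP; exists (Num.min d r); first by rewrite /= lt_min d0.
move=> z xz; have [Jz [Hz _]] := H z (xr _ (le_ball (min_ler _ _) xz)).
have /is_jacP[_ ->] := HJ; have /is_jacP[_ ->] := Hz.
rewrite distrC; apply: Hd Hz _ _; exact: (le_ball (min_lel _ _) xz).
Qed.

Lemma jac_cont_congr f g (U : set 'rV[R]_n) x : open U -> U x ->
  (forall y, U y -> f y = g y) -> jac_cont f x -> jac_cont g x.
Proof.
move=> Uo Ux fg [J [HJ H]]; exists J; split; first exact: is_jac_congr fg HJ.
move=> e e0; have [d [d0 Hd]] := H e e0.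
have /nbhs_ballP[r r0 xr] : nbhs x U by exact: open_nbhs_nbhs.
exists (Num.min d r); split; first by rewrite lt_min d0.
move=> z J' xz Hz; apply: (Hd z); first exact: (le_ball (min_lel _ _) xz).
apply: (is_jac_congr Uo _ _ Hz); last by move=> y /fg.
exact: (xr _ (le_ball (min_ler _ _) xz)).
Qed.

Local Notation e_ j := (delta_mx ord0 j : 'rV[R]_n).

(** Corners of the path from 0 to v that follows the axes in turn. The index k is a natural number
    so that the endpoint k = n is included. *)
Definition truncate_rV (v : 'rV[R]_n) k : 'rV[R]_n :=
  \row_l if (l < k)%N then v ord0 l else 0.

Lemma truncate_rVS v (k : 'I_n) :
  truncate_rV v k.+1 = truncate_rV v k + v ord0 k *: e_ k.
Proof.
apply/rowP => l; rewrite !mxE ltnS eqxx /=.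
have [->|lk] := eqVneq l k; first by rewrite leqnn ltnn add0r mulr1.
by rewrite mulr0 addr0 ltn_neqAle lk.
Qed.

(** The increment from x to x + v telescopes along an axis-parallel path, each of whose edges is
    controlled by [rd_increment]. The corners stay in the ball because balls are for the sup
    norm. *)
Lemma is_jac_of_rd f x r : 0 < r ->
  (forall i y, ball x r y -> cont_at (fun z => f z ord0 i) y) ->
  (forall i j y, ball x r y ->
    is_rd (fun z => f z ord0 i) j y (rd (fun z => f z ord0 i) j y)) ->
  (forall i j, cont_at (rd (fun z => f z ord0 i) j) x) ->
  is_jac f x (\matrix_(j, i) rd (fun z => f z ord0 i) j x).
Proof.
move=> r0 fc frd rdc e e0.
(* Each of the n edges costs at most 2 * e' * s; dividing by n + 1 instead of n also covers n =
   0. *)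
pose e' := e / (2 * n.+1%:R).
have n0 : 0 < n.+1%:R :> R by rewrite ltr0n.
have e'0 : 0 < e' by rewrite divr_gt0 // mulr_gt0.
have [d0 d00 Hd0] : exists2 d, 0 < d & forall (ij : 'I_m * 'I_n) z, ball x d z ->
    `|rd (fun z => f z ord0 ij.1) ij.2 z - rd (fun z => f z ord0 ij.1) ij.2 x| < e'.
  apply: (fin_min (P := fun (ij : 'I_m * 'I_n) d => forall z, ball x d z ->
    `|rd (fun z => f z ord0 ij.1) ij.2 z - rd (fun z => f z ord0 ij.1) ij.2 x| < e')).
    by move=> i d d' _ dd' H z xz; apply: H; exact: le_ball xz.
  by move=> [i j]; have [d [dp Hd]] := rdc i j e' e'0; exists d.
pose d := Num.min d0 r.
exists d; split; first by rewrite lt_min d00.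
move=> s v [vs [s0 sd]] i.
have vx k : ball x d (x + truncate_rV v k).
  apply/rV_ballP; split; first by rewrite lt_min d00.
  move=> l; rewrite !mxE opprD addrA subrr add0r normrN.
  apply: le_lt_trans sd; case: ifP => _; first exact: vs.
  by rewrite normr0.
have xd_r y : ball x d y -> ball x r y by move=> /(le_ball (min_ler _ _)).
have step (k : 'I_n) : `|f (x + truncate_rV v k.+1) ord0 i -
    f (x + truncate_rV v k) ord0 i - v ord0 k * rd (fun z => f z ord0 i) k x| <=
    2 * e' * s.
  have vk1 := vx k.+1; rewrite truncate_rVS addrA in vk1 *.
  apply: le_trans (rd_increment (h := fun z => f z ord0 i) e'0 _ _ (vx k) vk1) _.
  - by move=> y /xd_r; apply: fc.
  - move=> y xy; split; first exact: frd (xd_r _ xy).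
    exact: (Hd0 (i, k) y (le_ball (min_lel _ _) xy)).
  - by rewrite ler_pM2l ?mulr_gt0.
have -> : f (x + v) ord0 i - f x ord0 i =
    \sum_(k < n) (f (x + truncate_rV v k.+1) ord0 i - f (x + truncate_rV v k) ord0 i).
  rewrite -(big_mkord xpredT (fun k =>
    f (x + truncate_rV v k.+1) ord0 i - f (x + truncate_rV v k) ord0 i)).
  rewrite (telescope_sumr (fun k => f (x + truncate_rV v k) ord0 i)) //.
  congr (f _ _ _ - f _ _ _); apply/rowP => l; rewrite !mxE ?ltn_ord //.
  by rewrite addr0.
rewrite -sumrB (le_trans (ler_norm_sum _ _ _)) //.
apply: le_trans (_ : \sum_(k < n) 2 * e' * s <= _).
  by apply: ler_sum => k _; rewrite mxE.
rewrite sumr_const card_ord.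
have -> : (2 * e' * s) *+ n = n%:R * (2 * e') * s by rewrite -mulr_natl mulrA.
apply: ler_wpM2r => //.
have -> : n%:R * (2 * e') = e * (n%:R / n.+1%:R).
  by rewrite /e'; field; rewrite lt0r_neq0.
apply: ler_piMr; first exact: ltW.
by rewrite ler_pdivrMr // mul1r ler_nat.
Qed.

End Differential.

Section GenericC1.
Variables (R : realType) (D : forall n : nat, set (set 'rV[R]_n)).
Hypothesis HD : o_minimal D.

Lemma generic_jac_cont n m (f : 'rV[R]_n -> 'rV[R]_m) x r :
  defmap D f -> 0 < r ->
  (forall i y, ball x r y -> cont_at (fun z => f z ord0 i) y) ->
  exists x' r', [/\ 0 < r', ball x' r' `<=` ball x r &
    ball x' r' `<=` jac_cont f].
Proof.
move=> Df r0 fc.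
pose h i : 'rV[R]_n -> R^o := fun z => f z ord0 i.
have Dh i : defmap D (h i) by rewrite /h; definable.
(* The property is made conditional on [ball x r y] because [ball_pick] asks for it generically in
   the whole space, while f is only known to be continuous on that ball. *)
pose G (ij : 'I_m * 'I_n) : set 'rV[R]_n := fun y => ball x r y ->
  is_rd (h ij.1) ij.2 y (rd (h ij.1) ij.2 y) /\ cont_at (rd (h ij.1) ij.2) y.
have [|x1 [r1 [r10 xr1 HG]]] := @ball_pick R n _ G _ x r r0.
  move=> [i j] x1 r1 r10.
  have [xr1|nx] := pselect (exists2 y, ball x1 r1 y & ball x r y).
    have [y x1y xy] := xr1.
    have [s1 s10 ys1] := ball_sub x1y; have [s2 s20 ys2] := ball_sub xy.
    have s0 : 0 < Num.min s1 s2 by rewrite lt_min s10.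
    have [x2 [r2 [r20 xr2 H2]]] := generic_rd (x := y) HD j (Dh i) s0
      (fun z yz => fc i z (ys2 _ (le_ball (min_ler _ _) yz))).
    exists x2, r2; split => //; last by move=> z /H2 H _.
    by move=> z /xr2 /(le_ball (min_lel _ _)) /ys1.
  by exists x1, r1; split=> // y x1y xy; case: nx; exists y.
have {}HG i j y : ball x1 r1 y ->
    is_rd (h i) j y (rd (h i) j y) /\ cont_at (rd (h i) j) y.
  by move=> yb; apply: (HG (i, j)) => //; apply: xr1.
have HJ y : ball x1 r1 y ->
    is_jac f y (\matrix_(j, i) rd (fun z => f z ord0 i) j y).
  move=> /ball_sub[s s0 ys]; apply: (is_jac_of_rd s0).
  - by move=> i z /ys /xr1; exact: fc.
  - by move=> i j z /ys /(HG i j)[].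
  - by move=> i j; have [] := HG i j y (ys _ (ballxx y s0)).
exists x1, r1; split => // y yb; exists (\matrix_(j, i) rd (h i) j y).
split; first exact: HJ.
move=> e e0; have [s s0 ys] := ball_sub yb.
have [d d0 Hd] : exists2 d, 0 < d & forall (ij : 'I_m * 'I_n) z, ball y d z ->
    `|rd (h ij.1) ij.2 z - rd (h ij.1) ij.2 y| < e.
  apply: (fin_min (P := fun (ij : 'I_m * 'I_n) d => forall z, ball y d z ->
    `|rd (h ij.1) ij.2 z - rd (h ij.1) ij.2 y| < e)).
    by move=> i d d' _ dd' H z xz; apply: H; exact: le_ball xz.
  by move=> [i j]; have [_ /(_ e e0)[d [d0 Hd]]] := HG i j y yb; exists d.
exists (Num.min s d); split; first by rewrite lt_min s0.
move=> z J' yz /is_jacP[_ <-] i j.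
have /is_jacP[_ ->] := HJ z (ys z (le_ball (min_lel _ _) yz)).
by rewrite !mxE; apply: (Hd (j, i)); exact: (le_ball (min_ler _ _) yz).
Qed.

End GenericC1.

(** * Null sets *)

Section Null.
Variables (R : realType) (D : forall n : nat, set (set 'rV[R]_n)).
Hypothesis HD : o_minimal D.

Definition vol n (p : 'rV[R]_n * 'rV[R]_n) := \prod_i (p.2 ord0 i - p.1 ord0 i).

Definition open_box n (p : 'rV[R]_n * 'rV[R]_n) : set 'rV[R]_n :=
  [set x | forall i, p.1 ord0 i < x ord0 i < p.2 ord0 i].

Definition cube n (M : R) : set 'rV[R]_n := [set x | forall i, `|x ord0 i| <= M].

Lemma vol_ins n (a b : 'rV[R]_n) u v :
  vol (ins ord0 a u, ins ord0 b v) = (v - u) * vol (a, b).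
Proof.
rewrite /vol big_ord_recl /= !ins_at; congr (_ * _).
by apply: eq_bigr => i _; rewrite !ins_lift.
Qed.

Lemma open_box_ins n (a b x : 'rV[R]_n) u v t :
  open_box (ins ord0 a u, ins ord0 b v) (ins ord0 x t) <->
  open_box (a, b) x /\ u < t < v.
Proof.
split.
  move=> H; split; last by have := H ord0; rewrite /= !ins_at.
  by move=> i; have := H (lift ord0 i); rewrite /= !ins_lift.
move=> [H ut] i /=; case: (unliftP ord0 i) => [j|] ->; rewrite ?ins_lift ?ins_at //.
Qed.

Lemma open_box_ball n (p : 'rV[R]_n * 'rV[R]_n) x : open_box p x ->
  exists2 r, 0 < r & ball x r `<=` open_box p.
Proof.
move=> xp.
have [r r0 Hr] : exists2 r, 0 < r & forall i : 'I_n,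
    p.1 ord0 i <= x ord0 i - r /\ x ord0 i + r <= p.2 ord0 i.
  pose r i := Num.min (x ord0 i - p.1 ord0 i) (p.2 ord0 i - x ord0 i).
  have rp i : 0 < r i by have /andP[? ?] := xp i; rewrite lt_min !subr_gt0; apply/andP.
  exists (\big[Num.min/1]_i r i).
    by apply/bigmin_gtP; split => // i _; exact: rp.
  move=> i; have : \big[Num.min/1]_i r i <= r i by apply: bigmin_le.
  by rewrite le_min => /andP[h1 h2]; split; lra.
exists r => // y /rV_ballP[_ H] i; have [h1 h2] := Hr i.
have := H i; rewrite ltr_norml => /andP[h3 h4].
by apply/andP; split; lra.
Qed.

Definition small_cover n (K : set 'rV[R]_n) (e : R) :=
  exists s : seq ('rV[R]_n * 'rV[R]_n),
  [/\ forall p, p \in s -> forall i, p.1 ord0 i <= p.2 ord0 i,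
      forall x, K x -> exists2 p, p \in s & open_box p x &
      \sum_(p <- s) vol p < e].

Lemma cube_compact n M : compact (@cube n M).
Proof.
have := @rV_compact R n (fun _ => `[- M, M]%classic).
have -> : [set v : 'rV[R]_n | forall i, `[- M, M]%classic (v ord0 i)] = @cube n M.
  by apply/seteqP; split => x H i; have := H i; rewrite /= in_itv /= ler_norml.
by apply => i; apply: segment_compact.
Qed.

Lemma grid_index (M : R) (N : nat) (y : R) : 0 < M -> (0 < N)%N -> `|y| <= M ->
  exists j : 'I_N, - M + 2 * M / N%:R * j%:R <= y <= - M + 2 * M / N%:R * j.+1%:R.
Proof.
move=> M0 N0; rewrite ler_norml => /andP[My yM].
have NR : 0 < N%:R :> R by rewrite ltr0n.
pose P j := y <= - M + 2 * M / N%:R * j.+1%:R.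
have exP : exists j, P j.
  by exists N.-1; rewrite /P prednK // divfK ?gt_eqF //; lra.
have jN : (ex_minn exP < N)%N.
  case: ex_minnP => j _ /(_ N.-1); rewrite /P prednK // divfK ?gt_eqF //.
  by rewrite -[X in (_ < X)%N](prednK N0) ltnS; apply; lra.
exists (Ordinal jN) => /=; move: jN; case: ex_minnP => j Pj minj _.
apply/andP; split; last exact: Pj.
case: j Pj minj => [|j] Pj minj; first by rewrite mulr0 addr0.
rewrite leNgt; apply/negP => yj.
by have := minj j; rewrite /P ltW // ltnn => /(_ isT).
Qed.

(** A Lebesgue number argument: [F] is the filter of right neighbourhoods of 0, and near-covering
    compactness makes the local bounds on d uniform. *)
Lemma compact_uniform (T : pseudoMetricType R) (K : set T) (P : R -> T -> Prop) :
  compact K ->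
  (forall x, K x -> exists2 r, 0 < r &
    forall d y, 0 < d < r -> ball x r y -> P d y) ->
  exists2 d, 0 < d & forall d', 0 < d' < d -> forall y, K y -> P d' y.
Proof.
move=> /compact_near_coveringP Kc H.
pose F : set_system R := filter_from [set d | 0 < d] (fun d => [set e | 0 < e < d]).
have FF : Filter F.
  apply: filter_from_filter; first by exists 1 => /=.
  move=> d1 d2 /= d10 d20; exists (Num.min d1 d2); first by rewrite /= lt_min d10.
  by move=> e /= /andP[e0]; rewrite lt_min e0 => /andP[-> ->].
have [|d d0 Hd] := Kc _ F P FF; last by exists d.
move=> x /H[r r0 Hr]; exists (ball x r, [set e | 0 < e < r]) => /=.
  by split; [exact: nbhsx_ballx|exists r].
by move=> [y e] /= [xy er]; apply: Hr.
Qed.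

(** Upper semicontinuity of the fibers of a compact set: near a height outside the fiber over x, the
    closed set K misses a whole neighbourhood, and compactness of [[- M, M]] makes its size uniform
    in the height. *)
Lemma tube n (K : set 'rV[R]_n.+1) (M w : R) (s : seq R) x : closed K ->
  K `<=` @cube n.+1 M -> 0 < w -> (forall t, K (ins ord0 x t) -> t \in s) ->
  exists2 r, 0 < r & forall y t, ball x r y -> K (ins ord0 y t) ->
    exists2 u, u \in s & `|t - u| < w.
Proof.
move=> Kc KM w0 Ks.
have [||d d0 Hd] := compact_uniform (T := R^o) (K := `[- M, M]%classic)
  (P := fun d t => forall y, ball x d y ->
    K (ins ord0 y t) -> exists2 u, u \in s & `|t - u| < w).
- exact: segment_compact.
- move=> t _.
  have [Kt|nKt] := pselect (K (ins ord0 x t)).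
    exists w => // d t' _ tt' y _ _; exists t; first exact: Ks.
    by rewrite distrC.
  have nKo : open (~` K) by exact: closed_openC.
  have /nbhs_ballP[r r0 Hr] : nbhs (ins ord0 x t) (~` K) by exact: open_nbhs_nbhs.
  exists r => // d t' /andP[d0 dr] tt' y xy Ky; exfalso.
  by apply: (Hr (ins ord0 y t')) => //; apply/ins_ball; split => //; exact: le_ball (ltW dr) _ xy.
exists (d / 2); first by rewrite divr_gt0.
move=> y t xy Ky; apply: (Hd (d / 2) _ t _ y) => //.
  by apply/andP; split; lra.
by have := KM _ Ky ord0; rewrite ins_at /= in_itv /= ler_norml.
Qed.

Lemma defset_closure n (A : set 'rV[R]_n) : defset D A -> defset D (closure A).
Proof.
move=> DA; apply: (defset_ext (X := fun x : 'rV[R]_n => forall r : R^o, (0 < r :> R) ->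
    exists y : 'rV[R]_n, A y /\ ball x r y)); last by definable.
move=> x; split => [H B /nbhs_ballP[r r0 Hr]|H r r0].
  by have [y [Ay xy]] := H r r0; exists y; split => //; exact: Hr.
by have [y [Ay xy]] := H _ (nbhsx_ballx x r r0); exists y.
Qed.

(** False for arbitrary sets, such as the rational points; for definable ones it is nowhere
    density. *)
Lemma closure_thin n (A : set 'rV[R]_n) : defset D A -> ~ has_interior A ->
  ~ has_interior (closure A).
Proof.
move=> DA nA [x [r [r0 xr]]].
have [y [s [s0 yx nAy]]] := ndense_all HD DA nA x r0.
have [z [Az yz]] := xr y (yx _ (ballxx y s0)) _ (nbhsx_ballx y s s0).
exact: nAy Az.
Qed.

Lemma sum_len (s : seq R) (w : R) :
  \sum_(q <- [seq (t - w, t + w) | t <- s]) (q.2 - q.1) = (size s)%:R * (2 * w).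
Proof.
rewrite big_map; elim: s => [|t s IH]; first by rewrite big_nil mul0r.
by rewrite big_cons IH /= mulrS; ring.
Qed.

(* Induction on n: cover separately the part of K above a neighborhood of the base
   points with an infinite fiber, and, on a fine grid, the part above the other
   base points, whose fibers are locally covered by intervals of small length. *)
Lemma thin_small_cover n (K : set 'rV[R]_n) (M e : R) : defset D K -> closed K ->
  ~ has_interior K -> 0 < M -> K `<=` @cube n M -> 0 < e -> small_cover K e.
Proof.
elim: n K M e => [|n IH] K M e DK Kc nK M0 KM e0.
  exists [::]; split => //; last by rewrite big_nil.
  move=> x Kx; case: nK; exists x, 1; split => // y _.
  by rewrite (_ : y = x) //; apply/rowP => -[].
(* The heights of K lie in [- M, M], so the open interval ]- c, c[ contains them all. *)
pose c := M + 1; have c0 : 0 < c by rewrite /c; lra.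
have DA := defset_fat_fiber HD ord0 DK; set A := fat_fiber _ _ in DA.
have nA : ~ has_interior A by exact: (fat_fiber_thin HD DK).
have AM : closure A `<=` @cube n M.
  move=> x Ax i; rewrite leNgt; apply/negP => Mx.
  have e1 : 0 < `|x ord0 i| - M by rewrite subr_gt0.
  have [y [[u [v [uv Huv]]] /rV_ballP[_ xy]]] := Ax _ (nbhsx_ballx x _ e1).
  have Kyt : K (ins ord0 y ((u + v) / 2)) by apply: Huv; split; lra.
  have := KM _ Kyt (lift ord0 i); rewrite ins_lift => yM.
  have := xy i; have := lerB_dist (x ord0 i) (y ord0 i); lra.
(* Boxes above this cover will have height 2 * c, so their total volume is at most e / 2. *)
have [sA [sA1 sA2 sA3]] := IH (closure A) M (e / (4 * c)) (defset_closure DA)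
  (@closed_closure _ A) (closure_thin DA nA) M0 AM (divr_gt0 e0 (mulr_gt0 (ltr0n _ 4) c0)).
(* The N ^ n cells of side h = 2 * M / N are enlarged to side 3 * h, so their total base volume is
   (6 * M) ^ n; with heights adding up to at most eta above each cell, this costs at most e / 4. *)
pose eta := e / (4 * (6 * M) ^+ n).
have M6 : 0 < (6 * M) ^+ n by rewrite exprn_gt0 // mulr_gt0.
have eta0 : 0 < eta by rewrite divr_gt0 // mulr_gt0.
pose good (l : seq (R * R)) x := forall t, K (ins ord0 x t) ->
  exists2 q, q \in l & q.1 < t < q.2.
pose fine_list (l : seq (R * R)) := (forall q, q \in l -> q.1 <= q.2) /\
  \sum_(q <- l) (q.2 - q.1) <= eta.
pose covered x := exists2 p, p \in sA & open_box p x.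
have [||d d0 Hd] := compact_uniform (T := 'rV[R]_n) (K := @cube n M)
  (P := fun d x => covered x \/ exists l, fine_list l /\
    forall y, ball x d y -> good l y).
- exact: cube_compact.
- move=> x _; have [[p ps xp]|ncov] := pselect (covered x).
    have [r r0 Hr] := open_box_ball xp; exists r => // d y _ xy; left.
    by exists p => //; exact: Hr.
  have nAx : ~ A x by move=> Ax; apply/ncov/sA2/subset_closure.
  have [s Hs] := thin_fiber_finite HD DK nAx.
  pose w := eta / (2 * (size s).+1%:R).
  have s0 : 0 < (size s).+1%:R :> R by rewrite ltr0n.
  have w0 : 0 < w by rewrite divr_gt0 // mulr_gt0.
  have [r r0 Hr] := tube Kc KM w0 Hs.
  exists (r / 2); first by rewrite divr_gt0.
  move=> d y /andP[d0 dr] xy; right.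
  exists [seq (t - w, t + w) | t <- s]; split.
    split; first by move=> q /mapP[t _ ->] /=; lra.
    rewrite sum_len /w.
    have -> : (size s)%:R * (2 * (eta / (2 * (size s).+1%:R))) =
      eta * ((size s)%:R / (size s).+1%:R) by field; rewrite lt0r_neq0.
    by rewrite ler_piMr ?(ltW eta0) // ler_pdivrMr // mul1r ler_nat.
  move=> z yz t Kt.
  have xz : ball x r z.
    rewrite [r]splitr; apply: ball_triangle xy _; exact: le_ball (ltW dr) _ yz.
  have [u us tu] := Hr z t xz Kt.
  exists (u - w, u + w); first by apply/mapP; exists u.
  by move: tu; rewrite ltr_norml /= => /andP[h1 h2]; apply/andP; split; lra.
(* N exceeds 4 * M / d, which makes 2 * h less than d: a ball of radius 2 * h about any point of a
   cell contains the cell. *)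
pose N := (Num.trunc (4 * M / d)).+1.
have NR : 0 < N%:R :> R by rewrite ltr0n.
pose h := 2 * M / N%:R.
have h0 : 0 < h by rewrite divr_gt0 // mulr_gt0.
have hd : 2 * h < d.
  rewrite /h mulrA ltr_pdivrMr // mulrA -ltr_pdivrMl //.
  have := truncnS_gt (4 * M / d); rewrite -/N; set X := N%:R.
  by rewrite mulrC => ?; apply: le_lt_trans (_ : _ <= 4 * M / d) _ => //; lra.
pose cell (phi : {ffun 'I_n -> 'I_N}) (x : 'rV[R]_n) := forall i,
  - M + h * (phi i)%:R <= x ord0 i <= - M + h * (phi i).+1%:R.
have cells x : @cube n M x -> exists phi, cell phi x.
  move=> xM; have /choice[phi Hphi] : forall i, exists j : 'I_N,
    - M + h * j%:R <= x ord0 i <= - M + h * j.+1%:R.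
    by move=> i; apply: grid_index.
  by exists (finfun phi) => i; rewrite ffunE.
have /choice[l Hl] : forall phi, exists l, fine_list l /\ forall x,
    @cube n M x -> cell phi x -> ~ covered x -> good l x.
  move=> phi.
  have [[x [xM cx nx]]|nex] :=
      pselect (exists x, [/\ @cube n M x, cell phi x & ~ covered x]).
    have [|//|[l [lf Hl]]] := Hd (2 * h) _ x xM; first by rewrite hd mulr_gt0.
    exists l; split => // y yM cy ny; apply: Hl.
    apply/rV_ballP; split; first by rewrite mulr_gt0.
    move=> i; have /andP[h1 h2] := cx i; have /andP[h3 h4] := cy i.
    rewrite -natr1 mulrDr mulr1 in h2 h4.
    by rewrite ltr_norml; apply/andP; split; lra.
  exists [::]; split; first by split => //; rewrite big_nil ltW.
  by move=> x xM cx nx; case: nex; exists x.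
(* Each closed cell is widened by h on both sides, so that the open box over it contains it. *)
pose lo (phi : {ffun 'I_n -> 'I_N}) : 'rV[R]_n := \row_i (- M + h * (phi i)%:R - h).
pose hi (phi : {ffun 'I_n -> 'I_N}) : 'rV[R]_n := \row_i (- M + h * (phi i)%:R + 2 * h).
pose s1 := [seq (ins ord0 p.1 (- c), ins ord0 p.2 c) | p <- sA].
pose s2 := [seq (ins ord0 (lo phi) q.1, ins ord0 (hi phi) q.2) |
  phi <- enum {ffun 'I_n -> 'I_N}, q <- l phi].
exists (s1 ++ s2); split.
- move=> p; rewrite mem_cat => /orP[/mapP[q qs ->] i|].
    case: (unliftP ord0 i) => [j|] -> /=; rewrite ?ins_lift ?ins_at; last by lra.
    exact: sA1.
  move=> /allpairsPdep[phi [q [_ ql ->]]] i /=.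
  case: (unliftP ord0 i) => [j|] -> /=; rewrite ?ins_lift ?ins_at.
    by rewrite !mxE; lra.
  by have [[+ _] _] := Hl phi; apply.
- move=> z Kz; set x := col' ord0 z; set t := z ord0 ord0.
  have Ez : z = ins ord0 x t by rewrite ins_col'.
  have xM : @cube n M x by move=> i; rewrite mxE; exact: KM.
  have [[p ps xp]|nx] := pselect (covered x).
    exists (ins ord0 p.1 (- c), ins ord0 p.2 c).
      by rewrite mem_cat; apply/orP; left; apply/mapP; exists p.
    rewrite Ez; apply/open_box_ins; split; first by case: p xp {ps}.
    have := KM z Kz ord0; rewrite -/t ler_norml => /andP[h1 h2].
    by rewrite /c; apply/andP; split; lra.
  have [phi cx] := cells x xM; have [_ Hphi] := Hl phi.
  have [|q ql tq] := Hphi x xM cx nx t; first by rewrite -Ez.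
  exists (ins ord0 (lo phi) q.1, ins ord0 (hi phi) q.2).
    rewrite mem_cat; apply/orP; right; apply/allpairsPdep.
    by exists phi, q; rewrite mem_enum.
  rewrite Ez; apply/open_box_ins; split => // i.
  rewrite /= [lo phi _ _]mxE [hi phi _ _]mxE.
  have /andP[h1 h2] := cx i; rewrite -natr1 mulrDr mulr1 in h2.
  by apply/andP; split; lra.
rewrite big_cat /= big_map.
have -> : \sum_(p <- sA) vol (ins ord0 p.1 (- c), ins ord0 p.2 c) =
    2 * c * \sum_(p <- sA) vol p.
  rewrite mulr_sumr; apply: eq_bigr => -[a b] _.
  by rewrite vol_ins; congr (_ * _); ring.
have L1 : 2 * c * \sum_(p <- sA) vol p <= e / 2.
  have -> : e / 2 = 2 * c * (e / (4 * c)) by field; rewrite lt0r_neq0.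
  by rewrite ler_pM2l ?mulr_gt0 // ltW.
have L2 : \sum_(p <- s2) vol p <= e / 4.
  rewrite big_allpairs_dep /=.
  have -> : e / 4 = \sum_(phi <- enum {ffun 'I_n -> 'I_N}) (3 * h) ^+ n * eta.
    rewrite big_const_seq count_predT -cardE card_ffun !card_ord iter_addr_0.
    rewrite -[RHS]mulr_natl natrX mulrA -exprMn.
    have -> : N%:R * (3 * h) = 6 * M by rewrite /h; field; rewrite lt0r_neq0.
    by rewrite /eta; field; rewrite lt0r_neq0.
  apply: ler_sum => phi _.
  have -> : \sum_(q <- l phi) vol (ins ord0 (lo phi) q.1, ins ord0 (hi phi) q.2) =
      (3 * h) ^+ n * \sum_(q <- l phi) (q.2 - q.1).
    rewrite mulr_sumr; apply: eq_bigr => q _; rewrite vol_ins mulrC; congr (_ * _).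
    rewrite /vol /= -[in RHS](card_ord n) -prodr_const; apply: eq_bigr => i _.
    by rewrite !mxE; ring.
  rewrite ler_pM2l; last by rewrite exprn_gt0 // mulr_gt0.
  by have [[_ +] _] := Hl phi.
lra.
Qed.

End Null.

(** * From finite covers to outer measure zero *)

Section LebesgueOuter.
Variables (R : realType).

Lemma vol_ge0 n (p : 'rV[R]_n * 'rV[R]_n) :
  (forall i, p.1 ord0 i <= p.2 ord0 i) -> 0 <= vol p.
Proof. by move=> H; apply: prodr_ge0 => i _; rewrite subr_ge0. Qed.

Lemma lebesgue_outer_ge0 n (X : set 'rV[R]_n) : (0 <= lebesgue_outer X)%E.
Proof.
apply: le_ereal_inf_tmp => s [P [a [b [ab _ ->]]]].
apply: nneseries_ge0 => k _ _; rewrite lee_fin; apply: prodr_ge0 => i _.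
by rewrite subr_ge0.
Qed.

(** The k-th set is covered at cost e / 2 ^ (k + 1), and the finite lists of boxes are merged into
    one sequence by coding the pairs (list, position). *)
Lemma lebesgue_outer_bigcup0 n (X : set 'rV[R]_n) (F : nat -> set 'rV[R]_n) :
  X `<=` \bigcup_k F k -> (forall k e, 0 < e -> small_cover (F k) e) ->
  lebesgue_outer X = 0%E.
Proof.
move=> XF Fe; apply/eqP; rewrite eq_le lebesgue_outer_ge0 andbT.
apply/lee_addgt0Pr => e e0; rewrite add0e.
have /choice[s Hs] : forall k, exists s : seq ('rV[R]_n * 'rV[R]_n),
  [/\ forall p, p \in s -> forall i, p.1 ord0 i <= p.2 ord0 i,
      forall x, F k x -> exists2 p, p \in s & open_box p x &
      \sum_(p <- s) vol p < e / (2 ^ k.+1)%:R].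
  by move=> k; apply: Fe; rewrite divr_gt0 // ltr0n expn_gt0.
pose d0 : 'rV[R]_n * 'rV[R]_n := (0, 0).
pose g (q : nat * nat) := nth d0 (s q.1) q.2.
have gle q i : (g q).1 ord0 i <= (g q).2 ord0 i.
  have [qs|qs] := ltnP q.2 (size (s q.1)).
    by have [H _ _] := Hs q.1; apply: H; apply: mem_nth.
  by rewrite /g nth_default.
(* [P] keeps exactly the codes of actual boxes; the default box, whose volume is 1 when n = 0, must
   not be counted. *)
pose P k := if @pickle_inv (nat * nat)%type k is Some q
  then (q.2 < size (s q.1))%N else false.
pose gk k := if @pickle_inv (nat * nat)%type k is Some q then g q else d0.
have gkle k i : (gk k).1 ord0 i <= (gk k).2 ord0 i.
  by rewrite /gk; case: pickle_inv.
apply: (@le_trans _ _ (\sum_(0 <= k <oo | P k) (vol (gk k))%:E)%E).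
  apply: ereal_inf_lbound; exists P, (fun k => (gk k).1), (fun k => (gk k).2).
  split => // x /XF[k _ Fx]; have [_ H _] := Hs k; have [p ps px] := H x Fx.
  have ip : (index p (s k) < size (s k))%N by rewrite index_mem.
  exists (pickle (k, index p (s k))); first by rewrite /P /= pickleK_inv.
  move=> i; rewrite /gk pickleK_inv /g /= nth_index //.
  by have /andP[/ltW -> /ltW ->] := px i.
rewrite nneseries_esum; last by move=> k _; rewrite lee_fin vol_ge0.
rewrite (@reindex_esum _ _ _ (setT `*`` (fun k => `I_(size (s k)))) _ pickle).
  have -> : (\esum_(q in setT `*`` (fun k => `I_(size (s k)))) (vol (gk (pickle q)))%:E =
    \esum_(q in setT `*`` (fun k => `I_(size (s k)))) (vol (g (q.1, q.2)))%:E)%E.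
    by apply: eq_esum => -[k i] _; rewrite /gk pickleK_inv.
  rewrite -(esum_esum (a := fun k i => (vol (g (k, i)))%:E)); last first.
    by move=> k i _ _; rewrite lee_fin; apply: vol_ge0 => j.
  have E k : (\esum_(i in `I_(size (s k))) (vol (g (k, i)))%:E =
      (\sum_(p <- s k) vol p)%:E)%E.
    rewrite esum_fset; [|exact: finite_II|].
    2: by move=> i _; rewrite lee_fin; apply: vol_ge0 => j.
    rewrite -fsbig_ord sumEFin (big_nth d0) big_mkord //.
  under eq_esum do rewrite E.
  have s0 k : (0 <= (\sum_(p <- s k) vol p)%:E)%E.
    rewrite lee_fin big_seq; apply: sumr_ge0 => p ps; apply: vol_ge0.
    by have [H _ _] := Hs k; apply: H.
  rewrite -nneseries_esumT //.
  apply: le_trans (epsilon_trick0 xpredT (ltW e0)).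
  apply: lee_nneseries => // k _.
  by have [_ _ H] := Hs k; rewrite lee_fin ltW.
split.
- by move=> [k i] [_ /= ik]; rewrite /P pickleK_inv.
- by move=> q q' _ _; apply: (pcan_inj (@pickleK_inv _)).
- move=> k /=; rewrite /P; case E : pickle_inv => [q|//] qs.
  exists q => //; have := @pickle_invK (nat * nat)%type k.
  by rewrite E.
Qed.

End LebesgueOuter.

Section ThinNull.
Variables (R : realType) (D : forall n : nat, set (set 'rV[R]_n)).
Hypothesis HD : o_minimal D.

(** [thin_small_cover] treats closed bounded sets, so the closure, still without interior, is cut
    into its intersections with growing cubes. *)
Lemma lebesgue_outer_thin n (E : set 'rV[R]_n) : defset D E -> ~ has_interior E ->
  lebesgue_outer E = 0%E.
Proof.
move=> DE nE.
apply: (lebesgue_outer_bigcup0 (F := fun k => closure E `&` @cube R n k.+1%:R)).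
  move=> x Ex; exists (Num.trunc `|x|) => //; split; first exact: subset_closure.
  move=> i; apply: le_trans (rV_norm_coord x i) _.
  exact/ltW/truncnS_gt.
move=> k e e0; apply: (thin_small_cover (M := k.+1%:R) HD) => //.
- apply: defset_and => //; first exact: defset_closure.
  by rewrite /cube; definable.
- apply: closedI; first exact: closed_closure.
  by apply: compact_closed; [exact: norm_hausdorff|exact: cube_compact].
- apply: contra_not (closure_thin HD DE nE); apply: has_interior_sub.
  exact: subIsetl.
Qed.

End ThinNull.

(** * Critical points *)

Section Caratheodory.
Variables (R : realType) (V : vectType R).
Implicit Types (S : set V) (A : V).

Definition conv_comb S k A := exists (l : 'I_k -> R) (P : 'I_k -> V),
  [/\ forall i, 0 <= l i, \sum_i l i = 1, forall i, S (P i) &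
      A = \sum_i l i *: P i].

Lemma conv_comb_up S k A : conv_comb S k A -> conv_comb S k.+1 A.
Proof.
(* Padding repeats a point with weight 0. No point is available when k = 0, but then the weights
   cannot sum to 1. *)
case: k => [|k] [l [P [l0 l1 SP AE]]].
  by move: l1; rewrite big_ord0 => /esym/eqP; rewrite oner_eq0.
exists (fun i => oapp l 0 (unlift ord0 i)),
  (fun i => odflt (P ord0) (omap P (unlift ord0 i))).
split.
- by move=> i; case: unlift => //= j.
- rewrite big_ord_recl /= unlift_none /= add0r -l1; apply: eq_bigr => i _.
  by rewrite liftK.
- by move=> i; case: unlift => //= *; apply: SP.
rewrite AE [in RHS]big_ord_recl unlift_none /= scale0r add0r.
by apply: eq_bigr => i _; rewrite liftK.
Qed.

(** The matrix with rows (1, P i) has at most 1 + dim V columns, fewer than its k + 1 rows, hence a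
    nonzero left kernel vector c. Its entries sum to 0, so one of them is positive. *)
Lemma affine_dependence k (P : 'I_k.+1 -> V) : (dim V < k)%N ->
  exists2 c : 'I_k.+1 -> R, exists i, 0 < c i &
    \sum_i c i = 0 /\ \sum_i c i *: P i = 0.
Proof.
move=> Vk; pose B : 'M[R]_(k.+1, 1 + dim V) :=
  row_mx (const_mx 1) (\matrix_i v2r (P i)).
have : kermx B != 0.
  rewrite kermx_eq0; apply/negP => /eqP rB.
  by have := rank_leq_col B; rewrite rB add1n ltnNge Vk.
case/rowV0Pn => c /sub_kermxP cB c0.
have [cS cP] : \sum_i c ord0 i = 0 /\ \sum_i c ord0 i *: P i = 0.
  move: cB; rewrite mul_mx_row -row_mx0 => /eq_row_mx[/rowP/(_ ord0) c1 c2].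
  split.
    move: c1; rewrite !mxE => c1; rewrite -[RHS]c1.
    by apply: eq_bigr => i _; rewrite mxE mulr1.
  apply: v2r_inj; rewrite linear0 -[RHS]c2 linear_sum mulmx_sum_row.
  by apply: eq_bigr => i _; rewrite rowK linearZ.
exists (c ord0) => //; apply: contrapT => nc.
have cle i : c ord0 i <= 0 by rewrite leNgt; apply/negP => ci; apply: nc; exists i.
case/negP: c0; apply/eqP/rowP => i; rewrite mxE; apply/eqP; rewrite -oppr_eq0.
have : \sum_i - c ord0 i == 0 by rewrite sumrN cS oppr0.
rewrite psumr_eq0 => [/allP/(_ i)|j _]; last by rewrite oppr_ge0.
by rewrite mem_index_enum => /(_ isT).
Qed.

Lemma conv_comb_down S k A : (dim V < k)%N ->
  conv_comb S k.+1 A -> conv_comb S k A.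
Proof.
move=> Vk [l [P [l0 l1 SP AE]]].
have [c [i0 ci0] [c1 cP]] := affine_dependence P Vk.
(* The multiple t of c subtracted from the weights is the largest one keeping them nonnegative; it
   cancels the weight of j. *)
have [j cj jmin] := @arg_minP _ _ _ i0 (fun i => 0 < c i) (fun i => l i / c i) ci0.
pose t := l j / c j.
pose l' i := l i - t * c i.
have t0 : 0 <= t by rewrite divr_ge0 ?l0 ?ltW.
have l'0 i : 0 <= l' i.
  rewrite subr_ge0; have [ci|ci] := ltP 0 (c i).
    by rewrite -ler_pdivlMr //; apply: jmin.
  by apply: le_trans (l0 i); rewrite mulr_ge0_le0.
have l'j : l' j = 0 by rewrite /l' /t divfK ?subrr ?gt_eqF.
have l'1 : \sum_i l' i = 1 by rewrite sumrB -mulr_sumr c1 mulr0 subr0.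
have l'P : A = \sum_i l' i *: P i.
  under eq_bigr do rewrite scalerBl -scalerA.
  by rewrite sumrB -scaler_sumr cP scaler0 subr0.
exists (fun i => l' (lift j i)), (fun i => P (lift j i)); split => //.
  by move: l'1; rewrite (bigD1_ord j) //= l'j add0r.
by move: l'P; rewrite (bigD1_ord j) //= l'j scale0r add0r.
Qed.

Lemma conv_comb_dim S k A : conv_comb S k A -> conv_comb S (dim V).+1 A.
Proof.
have [kV|Vk] := leqP k (dim V).+1.
  rewrite -(subnKC kV); elim: (_ - _)%N => [|m IH]; first by rewrite addn0.
  by move=> /IH; rewrite addnS; exact: conv_comb_up.
rewrite -(subnKC (ltnW Vk)); elim: (k - _)%N => [|m IH]; first by rewrite addn0.
rewrite addnS => /conv_comb_down H; apply: IH; apply: H.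
by rewrite ltn_addr.
Qed.

Lemma conv_comb_convex S (C : set V) k A : @convex_set R V C -> S `<=` C ->
  conv_comb S k A -> C A.
Proof.
move=> Cc SC; elim: k A => [|k IH] A [l [P [l0 l1 SP ->]]].
  by move: l1; rewrite big_ord0 => /esym/eqP; rewrite oner_eq0.
move: l1; rewrite !big_ord_recl; set t := l ord0; set s := \sum_i l _ => l1.
have s0 : 0 <= s by apply: sumr_ge0.
have [sz|snz] := eqVneq s 0.
  rewrite sz addr0 in l1; rewrite l1 scale1r big1 ?addr0; first exact/SC/SP.
  move=> i _; move/eqP: sz; rewrite psumr_eq0 // => /allP/(_ i).
  by rewrite mem_index_enum => /(_ isT)/eqP ->; rewrite scale0r.
have t1 : 0 <= t <= 1 by rewrite l0 -l1 lerDl.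
pose B := \sum_i (l (lift ord0 i) / s) *: P (lift ord0 i).
have CB : C B.
  apply: IH; exists (fun i => l (lift ord0 i) / s), (fun i => P (lift ord0 i)).
  split => //.
    by move=> i; rewrite divr_ge0.
  by rewrite -mulr_suml divff.
have := Cc (P ord0) B (Itv01 (proj1 (andP t1)) (proj2 (andP t1))).
rewrite !inE => /(_ (SC _ (SP _)) CB).
rewrite /conv /=; congr C; congr (_ + _).
rewrite /B scaler_sumr; apply: eq_bigr => i _; rewrite scalerA; congr (_ *: _).
by rewrite /unstable.onem -l1 addrC addKr mulrC divfK.
Qed.

(** The hull is defined by quantifying over convex sets, which is not first-order. Bounding the
    number of points turns it into a quantifier over a finite-dimensional space. *)
Lemma convex_hullP S A : convex_hull S A <-> conv_comb S (dim V).+1 A.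
Proof.
split; last first.
  by move=> H C [Cc SC]; apply: conv_comb_convex Cc SC H.
apply; split; last first.
  move=> B SB; apply: (@conv_comb_dim _ 1); exists (fun _ => 1), (fun _ => B).
  by split => //; rewrite big_ord_recl big_ord0 ?addr0 ?scale1r.
move=> x y t; rewrite !inE => -[l [P [l0 l1 SP ->]]] [m [Q [m0 m1 SQ ->]]].
have u0 : 0 <= t%:num by []; have u1 : t%:num <= 1 by [].
(* A convex combination of two combinations concatenates their points; their number is then brought
   back to dim V + 1. *)
apply: (@conv_comb_dim _ ((dim V).+1 + (dim V).+1)).
exists (fun i : 'I_(_ + _) => match fintype.split i with
    inl i => t%:num * l i | inr i => (1 - t%:num) * m i end),
  (fun i : 'I_(_ + _) => match fintype.split i with
    inl i => P i | inr i => Q i end); split.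
- move=> i; case: fintype.split => j; by rewrite mulr_ge0 ?subr_ge0.
- rewrite big_split_ord /=.
  under eq_bigr do rewrite (unsplitK (inl _)).
  under [X in _ + X]eq_bigr do rewrite (unsplitK (inr _)).
  by rewrite -!mulr_sumr l1 m1 !mulr1 addrC subrK.
- by move=> i; case: fintype.split.
rewrite [RHS]big_split_ord /conv /= !scaler_sumr.
by congr (_ + _); apply: eq_bigr => i _;
  rewrite ?(unsplitK (inl _)) ?(unsplitK (inr _)) scalerA.
Qed.

End Caratheodory.

(** * Euclidean norm through sums of squares *)

Section EuclideanNorm.
Variable R : realType.

(** The square of [enorm], used in definable formulas because it is polynomial. *)
Definition sumsq m n (v : 'M[R]_(m, n)) := \sum_i \sum_j v i j ^+ 2.

Lemma sumsq_ge0 m n (v : 'M[R]_(m, n)) : 0 <= sumsq v.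
Proof. by apply: sumr_ge0 => i _; apply: sumr_ge0 => j _; apply: sqr_ge0. Qed.

Lemma coord_le_enorm m n (v : 'M[R]_(m, n)) i j : `|v i j| <= enorm v.
Proof.
rewrite -sqrtr_sqr; apply: ler_wsqrtr.
rewrite (bigD1 i) //= (bigD1 j) //= -addrA lerDl addr_ge0 //.
  by apply: sumr_ge0 => *; apply: sqr_ge0.
by apply: sumr_ge0 => *; apply: sumr_ge0 => *; apply: sqr_ge0.
Qed.

Lemma enorm_lt m n (v : 'M[R]_(m, n)) e : 0 < e ->
  (enorm v < e) <-> (sumsq v < e * e).
Proof.
move=> e0; rewrite -expr2 -[X in X < _ ^+ 2](sqr_sqrtr (sumsq_ge0 v)).
by rewrite ltr_pXn2r // ?nnegrE ?sqrtr_ge0 ?ltW.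
Qed.

Lemma enorm_eq1 m n (v : 'M[R]_(m, n)) : (enorm v = 1) <-> (sumsq v = 1).
Proof.
rewrite /enorm -/(sumsq v); split => [v1|->]; last exact: sqrtr1.
by rewrite -[LHS](sqr_sqrtr (sumsq_ge0 v)) v1 expr1n.
Qed.

Lemma sumsq_lt1 n (v : 'cV[R]_n) :
  (forall k, `|v k ord0| <= n.+1%:R^-1) -> sumsq v < 1.
Proof.
move=> H; have n0 : 0 < n.+1%:R :> R by rewrite ltr0n.
apply: le_lt_trans (_ : \sum_(i < n) n.+1%:R^-1 < _).
  apply: ler_sum => i _; rewrite big_ord_recl big_ord0 addr0.
  rewrite -real_normK ?num_real // expr2.
  apply: le_trans (_ : `|v i ord0| * 1 <= _); last by rewrite mulr1.
  rewrite ler_wpM2l //; apply: le_trans (H i) _.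
  by rewrite invf_le1 // ler1n.
rewrite sumr_const card_ord -[X in X < _]mulr_natl ltr_pdivrMr // mul1r.
by rewrite ltr_nat.
Qed.

End EuclideanNorm.

Section Nu.
Variables (R : realType) (n : nat) (O : set 'rV[R]_n) (f : 'rV[R]_n -> 'rV[R]_n).

(** The infima are nonnegative and grow as r decreases, so the limit is their supremum over r > 0
    and vanishes exactly when all of them do. *)
Lemma nu_eq0P x : nu O f x = 0%E <-> forall r e : R, 0 < r -> 0 < e ->
  exists (A : 'M[R]_n) (v : 'cV[R]_n),
    [/\ convex_hull (df_image O f (eball x r)) A, enorm v = 1 &
    enorm (A *m v) < e].
Proof.
pose F r := ereal_inf [set sigma A | A in convex_hull (df_image O f (eball x r))].
have sig0 (A : 'M[R]_n) : (0 <= sigma A)%E.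
  by apply: le_ereal_inf_tmp => _ [v _ <-]; rewrite lee_fin sqrtr_ge0.
have F0 r : (0 <= F r)%E by apply: le_ereal_inf_tmp => _ [A _ <-].
have Fmono r s : r <= s -> (F s <= F r)%E.
  move=> rs; apply: ereal_inf_le_tmp => _ [A HA <-]; exists A => // C [Cc SC].
  apply: HA; split => // B [y [[[xy Oy] ny] yB]]; apply: SC; exists y => //.
  by split => //; split => //; exact: lt_le_trans rs.
have nuE : nu O f x = ereal_sup [set F r | r in [set` `]0, +oo[%R]].
  apply/cvg_lim => //.
  by apply: nonincreasing_at_right_cvge => // r s _ _; exact: Fmono.
rewrite nuE; split.
  move=> sup0 r e r0 e0.
  have : (F r < e%:E)%E.
    apply: (@le_lt_trans _ _ 0%E); last by rewrite lte_fin.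
    rewrite -sup0; apply: ereal_sup_ubound; exists r => //=.
    by rewrite in_itv /= r0.
  move=> /ereal_inf_lt[_ [A HA <-]] /ereal_inf_lt[_ [v v1 <-]]; rewrite lte_fin => Av.
  by exists A, v.
move=> H; apply/eqP; rewrite eq_le; apply/andP; split.
  apply: ge_ereal_sup => y [r /=]; rewrite in_itv /= andbT => r0 <- {y}.
  apply/lee_addgt0Pr => e e0; rewrite add0e.
  have [A [v [HA v1 Av]]] := H r e r0 e0.
  apply: (@le_trans _ _ (sigma A)); first by apply: ereal_inf_lbound; exists A.
  apply: (@le_trans _ _ (enorm (A *m v))%:E); last by rewrite lee_fin ltW.
  by apply: ereal_inf_lbound; exists v.
apply: (@le_trans _ _ (F 1)) => //; apply: ereal_sup_ubound; exists 1 => //=.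
by rewrite in_itv /= ltr01.
Qed.

End Nu.

Section CriticalPoints.
Variables (R : realType) (n : nat) (O : set 'rV[R]_n).
Implicit Types f : 'rV[R]_n -> 'rV[R]_n.

(** The complement of [nonC1] in O in first-order form, with balls in place of arbitrary open
    sets. *)
Definition C1_point f (x : 'rV[R]_n) := exists r : R^o, (0 < r :> R) /\
  forall y : 'rV[R]_n, ball x r y -> O y /\ jac_cont f y.

Lemma nonC1P f x : nonC1 O f x <-> O x /\ ~ C1_point f x.
Proof.
split.
  move=> [Ox H]; split => // -[r [r0 Hr]].
  apply: (H (ball x r)); [exact: ball_open|exact: ballxx|by move=> y /Hr[]|].
  by apply/Ck1P; [exact: ball_open|move=> y /Hr[]].
move=> [Ox H]; split => // U Uo Ux UO /(Ck1P _ Uo) Hf; apply: H.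
have /nbhs_ballP[r r0 Hr] : nbhs x U by exact: open_nbhs_nbhs.
by exists r; split => // y /Hr Uy; split; [exact: UO|exact: Hf].
Qed.

Lemma C1_point_congr f g x : (forall y, O y -> f y = g y) ->
  C1_point f x -> C1_point g x.
Proof.
move=> fg [r [r0 Hr]]; exists r; split => // y yb; have [Oy Hy] := Hr y yb.
split => //; apply: (@jac_cont_congr _ _ _ f g (ball x r)) Hy => //.
  exact: ball_open.
by move=> z /Hr[/fg].
Qed.

Lemma df_imageP f U A : df_image O f U A <->
  exists x, [/\ U x, C1_point f x & is_jac f x A^T].
Proof.
split.
  move=> [x [[Ux Ox] nx] <-]; exists x.
  have Cx : C1_point f x by apply: contrapT => Cx; apply/nx/nonC1P.
  split => //; rewrite trmxK; apply: diff_is_jac.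
  by have [r [r0 /(_ x (ballxx x r0))[_ [J [/is_jacP[]]]]]] := Cx.
move=> [x [Ux Cx /is_jacP[df xA]]]; exists x; last by rewrite xA trmxK.
split; last by move=> /nonC1P[].
by split => //; have [r [r0 /(_ x (ballxx x r0))[]]] := Cx.
Qed.

(** Continuity keeps the Jacobians near x, and so their convex hull, close to J. A unit vector v
    almost killed by a matrix of that hull is almost killed by the transpose of J, and applying the
    inverse makes v too short. *)
Lemma nu_C1_point f x : C1_point f x -> jacobian f x \in unitmx ->
  nu O f x <> 0%E.
Proof.
move=> Cx Ju /nu_eq0P Hnu; set J := jacobian f x in Ju.
pose B := invmx J^T.
pose beta := \sum_k \sum_i `|B k i|.
have beta0 : 0 <= beta by do 2!apply: sumr_ge0 => ? _.
have n0 : 0 < n.+1%:R :> R by rewrite ltr0n.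
have b0 : 0 < beta + 1 by lra.
(* Chosen so that beta * gam is at most 1 / (n + 1), the bound on the entries of v that [sumsq_lt1]
   turns into a contradiction; beta + 1 keeps the denominator positive. Half of gam is for A v, and
   n * del is below the other half. *)
pose gam := (n.+1%:R * (beta + 1))^-1.
have gam0 : 0 < gam by rewrite invr_gt0 mulr_gt0.
pose del := gam / (2 * n.+1%:R).
have del0 : 0 < del by rewrite divr_gt0 // mulr_gt0.
have [r [r0 /(_ x (ballxx x r0))[_ [J' [HJ Hc]]]]] := Cx.
have JE : J' = J by have /is_jacP[_ <-] := HJ.
rewrite {}JE in HJ Hc; clearbody J.
have [d [d0 Hd]] := Hc del del0.
have [A [v [HA v1 Av]]] := Hnu d (gam / 2) d0 (divr_gt0 gam0 (ltr0n _ 2)).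
(* Entrywise closeness to the transpose of J is a convex condition, so it passes from the
   derivatives to their hull. *)
pose C : set 'M[R]_n := [set A | forall i j, `|A i j - J^T i j| <= del].
have CA : C A.
  apply: HA; split.
    move=> A1 A2 t; rewrite !inE => H1 H2 i j.
    have t0 : 0 <= t%:num by []; have t1 : 0 <= 1 - t%:num by rewrite subr_ge0.
    rewrite /conv /= !mxE /unstable.onem.
    have h1 := H1 i j; have h2 := H2 i j; rewrite mxE in h1 h2.
    have -> : t%:num * A1 i j + (1 - t%:num) * A2 i j - J j i =
      t%:num * (A1 i j - J j i) + (1 - t%:num) * (A2 i j - J j i) by ring.
    apply: le_trans (ler_normD _ _) _; rewrite !normrM (ger0_norm t0) (ger0_norm t1).
    apply: le_trans (lerD (ler_wpM2l t0 h1) (ler_wpM2l t1 h2)) _.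
    by rewrite -mulrDl addrC subrK mul1r.
  move=> A1 /df_imageP[y [xy _ yA]] i j; rewrite mxE.
  have := Hd y A1^T _ yA j i; rewrite mxE => H; apply/ltW/H.
  apply/rV_ballP; split => // k; apply: le_lt_trans xy.
  by have := coord_le_enorm (y - x) ord0 k; rewrite !mxE distrC.
have vk k : `|v k ord0| <= 1 by rewrite -v1; exact: coord_le_enorm.
have Jv i : `|(J^T *m v) i ord0| <= gam.
  have -> : J^T *m v = A *m v - (A - J^T) *m v.
    by rewrite mulmxBl opprB addrCA subrr addr0.
  have subE m (X Y : 'M[R]_(n, m)) k l : (X - Y) k l = X k l - Y k l.
    by rewrite !mxE.
  rewrite subE; apply: le_trans (ler_normB _ _) _.
  have h1 : `|(A *m v) i ord0| <= gam / 2.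
    exact: le_trans (coord_le_enorm _ _ _) (ltW Av).
  have h2 : `|((A - J^T) *m v) i ord0| <= gam / 2.
    rewrite mxE; apply: le_trans (ler_norm_sum _ _ _) _.
    apply: le_trans (_ : \sum_(j < n) del <= _).
      apply: ler_sum => j _; rewrite normrM -[del]mulr1.
      by apply: ler_pM => //; have := CA i j; rewrite -subE.
    rewrite sumr_const card_ord -[X in X <= _]mulr_natl /del.
    have -> : n%:R * (gam / (2 * n.+1%:R)) = gam / 2 * (n%:R / n.+1%:R).
      by field; rewrite lt0r_neq0.
    rewrite ler_piMr ?divr_ge0 ?(ltW gam0) // ler_pdivrMr // mul1r ler_nat.
    exact: leqnSn.
  lra.
have vs k : `|v k ord0| <= n.+1%:R^-1.
  have -> : v = B *m (J^T *m v) by rewrite mulKmx // unitmx_tr.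
  rewrite mxE; apply: le_trans (ler_norm_sum _ _ _) _.
  apply: le_trans (_ : \sum_j `|B k j| * gam <= _).
    by apply: ler_sum => j _; rewrite normrM ler_wpM2l.
  rewrite -mulr_suml; apply: le_trans (_ : beta * gam <= _).
    rewrite ler_wpM2r ?(ltW gam0) // /beta [leRHS](bigD1 k) //= lerDl.
    by do 2!apply: sumr_ge0 => ? _.
  rewrite /gam invfM mulrCA -[X in _ <= X]mulr1 ler_wpM2l ?invr_ge0 ?(ltW n0) //.
  by rewrite ler_pdivrMr // mul1r lerDl.
have := sumsq_lt1 vs; have /enorm_eq1 -> := v1.
by rewrite ltxx.
Qed.

End CriticalPoints.

(** * Definability of the set of critical points *)

Section DefinableCriticalPoints.
Variables (R : realType) (D : forall n : nat, set (set 'rV[R]_n)).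
Hypothesis HD : o_minimal D.

Lemma defmap_sumsq (V : vectType R) m n (f : V -> 'M[R]_(m, n)) :
  defmap D f -> defmap D (fun v => sumsq (f v) : R^o).
Proof.
move=> df; apply: (defmap_sum HD (f := fun i v => \sum_j f v i j ^+ 2 : R^o)) => i.
apply: (defmap_sum HD (f := fun j v => f v i j ^+ 2 : R^o)) => j.
have -> : (fun v => f v i j ^+ 2 : R^o) = (fun v => f v i j * f v i j : R^o).
  by apply/funext => v; rewrite expr2.
by definable.
Qed.

Lemma defmap_trmx (V : vectType R) m n (f : V -> 'M[R]_(m, n)) :
  defmap D f -> defmap D (fun v => (f v)^T).
Proof.
by move=> df; apply: (defmap_lincomp HD (g := trmx)) => // a x y; rewrite linearP.
Qed.

Lemma defmap_mulmx (V : vectType R) m n p (f : V -> 'M[R]_(m, n))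
    (g : V -> 'M[R]_(n, p)) :
  defmap D f -> defmap D g -> defmap D (fun v => f v *m g v).
Proof.
move=> df dg; apply: (defmap_matrix HD) => i j.
have -> : (fun v => (f v *m g v) i j : R^o) =
    (fun v => \sum_k f v i k * g v k j : R^o).
  by apply/funext => v; rewrite mxE.
apply: (defmap_sum HD (f := fun k v => f v i k * g v k j : R^o)) => k.
by apply: defmap_mul => //; definable.
Qed.

(** [defmap] concerns total functions, whereas f is only known to be definable over O. As O is open,
    the derivatives at points of O are unaffected. *)
Definition extend_by0 (T : Type) (V : zmodType) (O : set T) (f : T -> V) x :=
  if `[< O x >] then f x else 0.

Lemma extend_by0E (T : Type) (V : zmodType) (O : set T) (f : T -> V) x :
  O x -> extend_by0 O f x = f x.
Proof. by move=> Ox; rewrite /extend_by0; case: asboolP. Qed.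

Lemma defmap_extend_by0 m n (O : set 'rV[R]_m) (f : 'rV[R]_m -> 'rV[R]_n) :
  D O -> definable_map D O f -> defmap D (extend_by0 O f).
Proof.
move=> /(defsetE HD) DO Df.
pose r (p : 'rV[R]_m * 'rV[R]_n) := row_mx p.1 p.2.
have rL : linear r.
  by move=> a x y; rewrite /r /= scale_row_mx add_row_mx.
pose L : {linear _ -> _} := HB.pack r (GRing.isLinear.Build _ _ _ _ r rL).
have := defset_of_D HD L Df => DG.
apply: (defset_ext (X := fun p : 'rV[R]_m * 'rV[R]_n =>
  (O p.1 /\ p.2 = f p.1) \/ (~ O p.1 /\ p.2 = 0))).
  move=> [x y] /=; rewrite /extend_by0; case: asboolP => Ox; split.
  - by case=> -[].
  - by left.
  - by case=> -[].
  - by right.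
apply: (defset_or HD); last by definable.
apply: defset_ext DG => -[x y] /=.
by rewrite /r /= row_mxKl row_mxKr.
Qed.

Variables (n : nat) (O : set 'rV[R]_n) (f : 'rV[R]_n -> 'rV[R]_n).
Hypotheses (DO : defset D O) (Df : defmap D f).

Lemma defset_is_jac : defset D (fun p : 'rV[R]_n * 'M[R]_n => is_jac f p.1 p.2).
Proof. by rewrite /is_jac; definable. Qed.

Lemma defset_jac_cont : defset D (jac_cont f).
Proof.
have H := defset_is_jac.
rewrite /jac_cont; apply: defset_ex => //; apply: defset_and => //.
apply: defset_all => //; apply: defset_imp => //; first by definable.
apply: defset_ex => //; apply: defset_and => //; first by definable.
apply: defset_all => //; apply: defset_all => //.
apply: defset_imp => //; first by definable.
apply: defset_imp => //; last by definable.
by apply: (defset_rel HD H); definable.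
Qed.

Lemma defset_C1_point : defset D (C1_point O f).
Proof. by have H := defset_jac_cont; rewrite /C1_point; definable. Qed.

(** The weights form a row vector and the points a finite function, so that all quantifiers range
    over real vector spaces or finite types. *)
Lemma critical_pointsP x : critical_points O f x <-> O x /\
  forall r : R^o, 0 < r :> R -> forall e : R^o, 0 < e :> R ->
  exists (A : 'M[R]_n) (v : 'cV[R]_n),
    (exists (l : 'rV[R]_(dim 'M[R]_n).+1) (P : {ffun 'I_(dim 'M[R]_n).+1 -> 'M[R]_n}),
      (forall i, 0 <= l ord0 i :> R) /\ (\sum_i l ord0 i = 1 /\
      ((forall i, exists y : 'rV[R]_n, sumsq (y - x) < r * r :> R /\
          (C1_point O f y /\ is_jac f y (P i)^T)) /\
       A = \sum_i l ord0 i *: P i))) /\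
    (sumsq v = 1 /\ sumsq (A *m v) < e * e :> R).
Proof.
split=> -[Ox H]; split => //.
  move=> r r0 e e0; have /nu_eq0P/(_ r e r0 e0) := H.
  move=> [A [v [/convex_hullP[l [P [l0 l1 SP AE]]] v1 Av]]]; exists A, v.
  split; last by split; [exact/enorm_eq1|exact/enorm_lt].
  exists (\row_i l i), [ffun i => P i]; split; first by move=> i; rewrite mxE.
  split; first by under eq_bigr do rewrite mxE.
  split; last by under eq_bigr do rewrite mxE ffunE.
  move=> i; rewrite ffunE; have /df_imageP[y [xy Cy yP]] := SP i.
  by exists y; split => //; apply/enorm_lt.
apply/nu_eq0P => r e r0 e0.
have [A [v [[l [P [l0 [l1 [SP AE]]]]] [v1 Av]]]] := H r r0 e e0.
exists A, v; split; [|exact/enorm_eq1|exact/enorm_lt].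
apply/convex_hullP; exists (l ord0), P; split => // i.
have [y [xy [Cy yP]]] := SP i; apply/df_imageP; exists y; split => //.
exact/enorm_lt.
Qed.

Lemma defset_critical_points : defset D (critical_points O f).
Proof.
have H1 := defset_is_jac; have H2 := defset_C1_point.
apply: (defset_ext (fun x => iff_sym (critical_pointsP x))).
apply: defset_and => //.
apply: defset_all => //; apply: defset_imp => //; first by definable.
apply: defset_all => //; apply: defset_imp => //; first by definable.
apply: defset_ex => //; apply: defset_ex => //; apply: defset_and => //; last first.
  apply: defset_and => //.
    by apply: defset_eq => //; [apply: defmap_sumsq|]; definable.
  apply: defset_lt => //; last by definable.
  by apply: defmap_sumsq; apply: defmap_mulmx; definable.
apply: defset_ex => //; apply: defset_ex => //; apply: defset_and => //.
  by definable.
apply: defset_and => //; first by definable.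
apply: defset_and => //; last by definable.
apply: defset_all_fin => // i; apply: defset_ex => //; apply: defset_and => //.
  by apply: defset_lt => //; [apply: defmap_sumsq|]; definable.
apply: defset_and => //; first by definable.
by apply: (defset_rel HD H1); [|apply: defmap_trmx]; definable.
Qed.

End DefinableCriticalPoints.

Section Congruence.
Variables (R : realType) (n : nat) (O : set 'rV[R]_n).
Variables f g : 'rV[R]_n -> 'rV[R]_n.
Hypothesis fg : forall y, O y -> f y = g y.

Lemma df_image_sub U : df_image O f U `<=` df_image O g U.
Proof.
move=> A /df_imageP[x [Ux Cx xA]]; apply/df_imageP; exists x; split => //.
  exact: C1_point_congr fg Cx.
have [r [r0 Hr]] := Cx.
apply: (@is_jac_congr _ _ _ f g (ball x r)) xA; first exact: ball_open.
  exact: ballxx.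
by move=> y /Hr[/fg].
Qed.

End Congruence.

(** * Critical values have empty interior *)

Section Sard.
Variables (R : realType) (D : forall n : nat, set (set 'rV[R]_n)).
Hypothesis HD : o_minimal D.
Variables (n : nat) (O : set 'rV[R]_n).
Hypothesis Oopen : open O.
Hypothesis DO : defset D O.

Lemma critical_values_congr (f g : 'rV[R]_n -> 'rV[R]_n) :
  (forall y, O y -> f y = g y) -> critical_values O f = critical_values O g.
Proof.
move=> fg.
have E : df_image O f = df_image O g.
  apply/funext => U; apply/seteqP; split; first exact: df_image_sub.
  by apply: df_image_sub => y /fg.
have C : critical_points O f = critical_points O g.
  by rewrite /critical_points /nu E.
rewrite /critical_values C; apply/seteqP; split => y [x Cx <-];
  have [Ox _] := Cx; exists x; try exact: Cx.
  exact: esym (fg x Ox).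
exact: fg x Ox.
Qed.

Variable f : 'rV[R]_n -> 'rV[R]_n.
Hypothesis Df : defmap D f.
Hypothesis fcont : forall x, O x -> forall i, cont_at (fun z => f z ord0 i) x.

Lemma defset_critical_values : defset D (critical_values O f).
Proof.
have H := defset_critical_points HD DO Df.
apply: (defset_ext (X := fun y => exists x, critical_points O f x /\ y = f x)).
  by move=> y; split; [move=> [x [Cx ->]]|move=> [x Cx <-]]; exists x.
by move: (critical_points O f) H => C H; definable.
Qed.

Lemma C1_point_inverse (g : 'rV[R]_n -> 'rV[R]_n) y r : 0 < r ->
  (forall z, ball y r z -> f (g z) = z) -> jac_cont g y ->
  C1_point O f (g y) -> jacobian f (g y) \in unitmx.
Proof.
move=> r0 fgK [G [/is_jacP[dg <-] _]] [s [s0 /(_ _ (ballxx (g y) s0))]].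
move=> [_ [J [/is_jacP[df _] _]]].
have Hid : is_jac (f \o g) y 1%:M.
  apply: (@is_jac_congr _ _ _ idfun _ (ball y r)); first exact: ball_open.
  - exact: ballxx.
  - by move=> z /fgK.
  move=> e e0; exists 1; split=> // t v [vt [t0 _]] i.
  have -> : \sum_k v ord0 k * (1%:M : 'M[R]_n) k i = v ord0 i.
    rewrite (bigD1 i) //= mxE eqxx mulr1 big1 ?addr0 // => k ki.
    by rewrite mxE (negbTE ki) mulr0.
  have -> : (idfun (y + v) : 'rV[R]_n) ord0 i - (idfun y : 'rV[R]_n) ord0 i -
      v ord0 i = 0.
    by rewrite /= mxE addrAC addrK subrr.
  by rewrite normr0 mulr_ge0 // ltW.
have /is_jacP[_ J1] := Hid.
(* Jacobians act on row vectors from the right, so the factor of g, applied first, stands on the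
   left. *)
have : jacobian g y *m jacobian f (g y) = 1%:M.
  rewrite -J1.
  have K (A B C : 'M[R]_n) (u w : 'rV[R]_n -> 'rV[R]_n) :
      (forall v, v *m A = u v) -> (forall v, v *m B = w v) ->
      (forall v, v *m C = w (u v)) -> A *m B = C.
    move=> uA wB wuC; apply/row_matrixP => i.
    by rewrite row_mul !rowE uA wB wuC.
  apply: (K _ _ _ _ _ (mul_rV_lin1 _) (mul_rV_lin1 _)) => v.
  apply: etrans (mul_rV_lin1 _ _) _.
  exact: (congr1 (fun h => h v) (diff_comp dg df)).
by case/mulmx1_unit.
Qed.

Lemma critical_values_thin : ~ has_interior (critical_values O f).
Proof.
move=> [y0 [r0 [r00 Hy0]]].
have DC := defset_critical_points HD DO Df.
have [||y1 [r1 [g [r10 _ Dg Hg]]]] := definable_choice HD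
  (X := fun y x => critical_points O f x /\ y = f x) (x := y0) _ r00.
- by move: (critical_points O f) DC => C DC; definable.
- by move=> y /Hy0[x Cx <-]; exists x.
have [|y2 [r2 [r20 yr2 gc]]] := ball_pick (G := fun i => cont_at (fun z => g z ord0 i))
  _ y1 r10.
  move=> i x r r0'; apply: (generic_continuity HD) => //.
  by definable.
have [|y3 [r3 [r30 yr3 Jg]]] := generic_jac_cont HD (x := y2) Dg r20.
  by move=> i y yb; apply: gc.
have gcrit y : ball y3 r3 y -> critical_points O f (g y) /\ f (g y) = y.
  by move=> /yr3 /yr2 /Hg[].
have [[y yb Cy]|nC] := pselect (exists2 y, ball y3 r3 y & C1_point O f (g y)).
  have [s s0 ys] := ball_sub yb.
  have := C1_point_inverse s0 (fun z yz => proj2 (gcrit z (ys z yz))) (Jg y yb) Cy.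
  by move=> /(nu_C1_point Cy); have [[_ ->]] := gcrit y yb.
have DCf := defset_C1_point HD DO Df.
(* The relation is the graph of f over its non-C^1 points, which is functional from points to
   values. Its image contains the ball because each y there is the value of f at g y. *)
have [|||x [s [s0 xs]]] := @has_interior_domain _ _ HD n
  (fun x y => (O x /\ ~ C1_point O f x) /\ y = f x).
- by move: (C1_point O f) DCf => C DCf; definable.
- by move=> x z z' [_ ->] [_ ->].
- exists y3, r3; split => // y yb; have [[Og _] fg] := gcrit y yb.
  exists (g y); split; last by [].
  by split => // Cy; apply: nC; exists y.
have xO z : ball x s z -> O z by move=> /xs[y [[]]].
have [|x' [s' [s'0 xs' Jf]]] := generic_jac_cont HD (x := x) Df s0.
  by move=> i z /xO /fcont.
have [y [[_ nCx] _]] := xs x' (xs' _ (ballxx x' s'0)).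
by apply: nCx; exists s'; split => // z zb; split; [apply/xO/xs'|exact: Jf].
Qed.

End Sard.

(** * From empty interior to small dimension *)

Lemma submanifold_full_has_interior (R : realType) p n (M : set 'rV[R]_n) :
  submanifold p n M -> M !=set0 -> has_interior M.
Proof.
move=> [_ HM] [x Mx]; have [U [V [phi [psi [[Uo Ux _] _ _ _ HU]]]]] := HM x Mx.
have /nbhs_ballP[r r0 Hr] : nbhs x U by exact: open_nbhs_nbhs.
exists x, r; split => // y /Hr Uy; apply/HU => // i.
by rewrite leqNgt ltn_ord.
Qed.

(** A piece of dimension n would contain a ball, since a chart then imposes no equation. The bound n
    - 1, common to all decompositions, keeps the inequality strict through the supremum. *)
Lemma dimension_thin (R : realType) (D : forall n : nat, set (set 'rV[R]_n)) p n
    (X : set 'rV[R]_n) :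
  ~ has_interior X -> (dimension D p X < n%:R%:E)%E.
Proof.
move=> nX; apply: (@le_lt_trans _ _ (n%:R - 1)%:E); last first.
  by rewrite lte_fin gtrDl oppr_lt0.
apply: ge_ereal_sup => _ [N [M [d [[XM _ HM] ->]]]].
apply: bigmax_le; first exact: leNye.
move=> i _; have [_ Mi sM] := HM i.
have din : (d i < n)%N.
  have [dn _] := sM; rewrite ltn_neqAle dn andbT; apply/negP => /eqP din.
  rewrite din in sM; apply: nX.
  apply: has_interior_sub (submanifold_full_has_interior sM Mi).
  by rewrite XM => y My; exists i.
by rewrite lee_fin lerBrDr natr1 ler_nat.
Qed.

Theorem theorem3p1 (R : realType) (D : forall n : nat, set (set 'rV[R]_n))
    (HD : o_minimal D) (n : nat) (Omega : set 'rV[R]_n)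
    (f : 'rV[R]_n -> 'rV[R]_n)
    (Oopen : open Omega) (Odef : D n Omega)
    (fcont : {within Omega, continuous f})
    (fdef : definable_map D Omega f) :
  [/\ D n (critical_values Omega f),
      forall p : nat, (dimension D p (critical_values Omega f) < n%:R%:E)%E &
      lebesgue_outer (critical_values Omega f) = 0%E].
Proof.
have DO : defset D Omega by apply/(defsetE HD).
pose f0 := extend_by0 Omega f.
have ff0 y : Omega y -> f y = f0 y by move=> Oy; rewrite /f0 extend_by0E.
have Df0 : defmap D f0 by exact: defmap_extend_by0.
have f0cont x : Omega x -> forall i, cont_at (fun z => f0 z ord0 i) x.
  move=> Ox i e e0.
  have fx : {for x, continuous f}.
    by move: fcont; rewrite continuous_open_subspace // => /(_ x); rewrite inE; apply.
  have /cont_atP/(_ e e0)[d [d0 Hd]] : {for x, continuous (fun z => f z ord0 i)}.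
    exact: (continuous_comp fx (@coord_continuous _ _ _ ord0 i (f x))).
  have /nbhs_ballP[r r0 Hr] : nbhs x Omega by exact: open_nbhs_nbhs.
  exists (Num.min d r); split; first by rewrite lt_min d0.
  move=> z xz; rewrite -!ff0 //; first exact: Hd (le_ball (min_lel _ _) xz).
  exact: Hr (le_ball (min_ler _ _) xz).
rewrite (critical_values_congr ff0).
have DZ := defset_critical_values HD DO Df0.
have nZ := critical_values_thin HD DO Df0 f0cont.
split; first exact/(defsetE HD).
  by move=> p; exact: dimension_thin.
exact: (lebesgue_outer_thin HD DZ nZ).
Qed.
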